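(* Suppose that one observes independent variables $Y_1,\dots,Y_n$ taking values in $\{1,2,\dots,r\}$ with $r\in\mathbb N$, $r\ge2$. For $t\in\{1,\dots,n\}$ and $i\in\{1,\dots,r\}$ let $s(t,i)=P(Y_t=i)$, and consider a collection $\mathcal M_n$ of partitions constructed on the grid $\{1,\dots,n\}$. Let $(L_m)_{m\in\mathcal M_n}$ be some family of positive weights and define $$\Sigma=\sum_{m\in\mathcal M_n}\exp(-L_m|m|)<+\infty.$$ Assume that - there exists some positive absolute constant $\rho$ such that $s\ge\rho$ (i.e. $s(t,i)\ge\rho$ for all $t,i$), - $\mathcal M_n$ is a collection of partitions constructed on a partition $m_f$ such that $|J|\ge\Gamma[\log(n)]^2$ for all $J\in m_f$, where $\Gamma$ is a positive absolute constant. Let $\lambda_\varepsilon>1/2$. If for every $m\in\mathcal M_n$ $$pen(m)\ge\lambda_\varepsilon\,r\,|m|\,\bigl(1+4\sqrt{L_m}\bigr)^2,$$ then $$\mathbb E\bigl[h^2(s,\hat s_{\hat m})\bigr]\le C_{\lambda_\varepsilon}\inf_{m\in\mathcal M_n}\{K(s,\bar s_m)+pen(m)\}+C(\Sigma,r,\lambda_\varepsilon,\rho,\Gamma),$$ with $$C_{\lambda_\varepsilon}=\frac{2(2\lambda_\varepsilon)^{1/3}}{(2\lambda_\varepsilon)^{1/3}-1}.$$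
   Context: Partitions $m$ of $\{1,\dots,n\}$ are into segments (intervals) $J$; $|m|$ is the number of segments and $|J|$ the number of points of $J$. ''Constructed on $m_f$'' means every segment of every $m\in\mathcal M_n$ is a union of segments of $m_f$. $\mathcal S_m$ is the set of $u:\{1,\dots,n\}\times\{1,\dots,r\}\to[0,1]$ (with $u(t,\cdot)$ a probability vector) such that $u(t,i)=u(t',i)$ for all $i$ and all $t,t'$ in the same segment $J\in m$. Contrast: $\gamma(u)=-\sum_{t=1}^n\sum_{i=1}^r\mathbf 1_{\{Y_t=i\}}\log u(t,i)$. Kullback–Leibler: $K(s,u)=\sum_{t=1}^n\sum_{i=1}^rs(t,i)\log\frac{s(t,i)}{u(t,i)}$. Squared Hellinger distance: $h^2(s,u)=\frac12\sum_{t=1}^n\sum_{i=1}^r(\sqrt{s(t,i)}-\sqrt{u(t,i)})^2$. Minimum contrast estimator: $\hat s_m(t,i)=N_J(i)/|J|$ for $t\in J\in m$, with $N_J(i)=\sum_{t\in J}\mathbf 1_{\{Y_t=i\}}$. Projection: $\bar s_m(t,i)=|J|^{-1}\sum_{t'\in J}s(t',i)$ for $t\in J\in m$. For a penalty $pen:\mathcal M_n\to\mathbb R_+$, $\hat m=\arg\min_{m\in\mathcal M_n}\{\gamma(\hat s_m)+pen(m)\}$. $C(\Sigma,r,\lambda_\varepsilon,\rho,\Gamma)$ is a positive constant depending only on the listed quantities. *)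

(* Defs.v *)
From mathcomp Require Import all_boot all_order all_algebra.
From mathcomp Require Import all_classical all_reals all_analysis.

Set Implicit Arguments.
Unset Strict Implicit.
Unset Printing Implicit Defensive.

Import Order.TTheory GRing.Theory Num.Theory.

Local Open Scope ring_scope.

(* The grid {1, ..., n} and the alphabet {1, ..., r} are the ordinals 'I_n and
   'I_r, i.e. both are numbered from 0.  A family (u(t, i)) is a function
   'I_n -> 'I_r -> R. *)

Section Partitions.
Variable n : nat.
Implicit Types (J : {set 'I_n}) (m mf : {set {set 'I_n}}).

Definition is_segment J : Prop :=
  forall t1 t t2 : 'I_n,
    t1 \in J -> t2 \in J -> (t1 <= t)%N -> (t <= t2)%N -> t \in J.

Definition segment_partition m : Prop :=
  finset.partition m [set: 'I_n]%SET /\ (forall J, J \in m -> is_segment J).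

Definition constructed_on mf m : Prop :=
  forall J, J \in m -> exists2 B : {set {set 'I_n}}, B \subset mf & J = finset.cover B.

End Partitions.

Section Divergences.
Variables (R : realType) (n r : nat).
Implicit Types s u : 'I_n -> 'I_r -> R.

(* Real-valued: no value +oo is provided for s t i > 0 = u t i, so this is the
   Kullback-Leibler divergence only when u > 0 wherever s > 0. *)
Definition KL s u : R :=
  \sum_(t < n) \sum_(i < r) s t i * ln (s t i / u t i).

Definition hellinger2 s u : R :=
  2^-1 * \sum_(t < n) \sum_(i < r) (Num.sqrt (s t i) - Num.sqrt (u t i)) ^+ 2.

(* [pblock m t] is the segment J of m with t \in J. *)
Definition projection s (m : {set {set 'I_n}}) : 'I_n -> 'I_r -> R :=
  fun t i =>
    (#|finset.pblock m t|%:R)^-1 * \sum_(t' in finset.pblock m t) s t' i.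

End Divergences.

(* Here y : 'I_n -> 'I_r is an observed sample (Y_1(w), ..., Y_n(w)). *)
Section Contrast.
Variables (R : realType) (n r : nat).
Implicit Types (y : 'I_n -> 'I_r) (m : {set {set 'I_n}}).

(* A summand with y t = i and u t i = 0 would be +oo on paper and is 0 here,
   since ln 0 = 0; this does not occur for u = mc_estimator y m, which is
   positive at (t, y t). *)
Definition contrast y (u : 'I_n -> 'I_r -> R) : R :=
  - \sum_(t < n) \sum_(i < r) (y t == i)%:R * ln (u t i).

Definition mc_estimator y m : 'I_n -> 'I_r -> R :=
  fun t i =>
    (\sum_(t' in finset.pblock m t) (y t' == i)%:R) / #|finset.pblock m t|%:R.

Definition penalized_criterion y (pen : {set {set 'I_n}} -> R) m : R :=
  contrast y (mc_estimator y m) + pen m.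

Definition is_argmin (M : {set {set {set 'I_n}}})
    (crit : {set {set 'I_n}} -> R) (m : {set {set 'I_n}}) : Prop :=
  m \in M /\ (forall m', m' \in M -> crit m <= crit m').

End Contrast.

Section DiscreteVariables.
Context {d : measure_display} {T : measurableType d} {R : realType}.

(* Measurability for the discrete sigma-algebra on a finite type. *)
Definition discrete_rv (F : finType) (X : T -> F) : Prop :=
  forall x : F, measurable (X @^-1` [set x])%classic.

Definition mutually_independent (P : probability T R) (n r : nat)
    (Y : 'I_n -> T -> 'I_r) : Prop :=
  forall (B : {set 'I_n}) (A : 'I_n -> set 'I_r),
    P (\bigcap_(t in [set` B]) (Y t @^-1` A t))%classic =
    (\prod_(t in B) P (Y t @^-1` A t)%classic)%E.

Definition law (P : probability T R) (n r : nat)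
    (Y : 'I_n -> T -> 'I_r) : 'I_n -> 'I_r -> R :=
  fun t i => fine (P (Y t @^-1` [set i])%classic).

End DiscreteVariables.

(* Main.v *)
(* By minimality of the criterion and the identity
   contrast(s_m) - contrast(shat_m) = sum_(J in m) |J| KL(shat_J, s_J)
   (s_m the projection, shat_m the estimator), Delta_m' := contrast s -
   contrast s_m' and Khat_m' := sum_(J in m') |J| KL(shat_J, s_J) satisfy, with
   kappa = (2 lambda)^(1/3) and A = 2 kappa / (kappa - 1),
     h^2(s, shat_m') <= A (contrast s_m - contrast s + pen m)
       + A [2/A h^2(s, s_m') + Delta_m' + (1 + 1/A) Khat_m' - pen m']
   for the selected m'.  The bracket is controlled by exponential moments,
   summed over m'.  E exp(Delta_m' / 2) is a product of Hellinger affinities,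
   at most exp(- h^2(s, s_m')).  Khat_m' is a sum of independent terms over the
   segments; on the event that all counts N_J(i) are within a factor 1 +- eps of
   their means each term is at most a sum over i of terms
   (N_J(i) - E N_J(i))^2 / (2 (1 - eps) E N_J(i)), of mean at most
   1 / (2 (1 - eps)), whose exponential moments follow from Chernoff tails.
   The log^2 n lower bound on the segments of mf makes the complementary event
   have probability O(1/n), while h^2 <= n. *)

Require Import Defs.
From mathcomp Require Import all_boot all_order all_algebra.
From mathcomp Require Import all_classical all_reals all_analysis.
From mathcomp Require Import ring lra.

Set Implicit Arguments.
Unset Strict Implicit.
Unset Printing Implicit Defensive.

Import Order.TTheory GRing.Theory Num.Theory.
Import numFieldNormedType.Exports.

Local Open Scope ring_scope.

(** * Elementary inequalities *)

Section RealBounds.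
Variable R : realType.
Implicit Types (f df : R -> R) (a b x u l eps s k : R).

Lemma derive_ge0_le f df a b : a <= b ->
  (forall x, a <= x <= b -> is_derive x 1 f (df x)) ->
  (forall x, a <= x <= b -> 0 <= df x) -> f a <= f b.
Proof.
move=> ab fdf df0.
have Dab x : x \in `]a, b[%R -> is_derive x 1 f (df x).
  by rewrite in_itv/= => /andP[xa xb]; apply: fdf; rewrite !ltW.
have Cab : {within `[a, b], continuous f}%classic.
  apply: derivable_within_continuous => x; rewrite in_itv/= => xab.
  by have [] := fdf x xab.
have [c cab fE] := MVT_segment ab Dab Cab.
by rewrite -subr_ge0 fE mulr_ge0 ?subr_ge0// df0// -in_itv.
Qed.

Lemma derive_le0_ge f df a b : a <= b ->
  (forall x, a <= x <= b -> is_derive x 1 f (df x)) ->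
  (forall x, a <= x <= b -> df x <= 0) -> f b <= f a.
Proof.
move=> ab fdf df0; rewrite -lerN2.
apply: (@derive_ge0_le (fun x => - f x) (fun x => - df x)) => // x xab.
  by have := fdf x xab => ?; apply: is_derive_eq.
by rewrite oppr_ge0 df0.
Qed.

(** The difference of the two sides vanishes at 0 and is monotone on each side of it: its derivative
    is signed by [expR x <= 1 / (1 - x)] for [x >= 0] and by [1 + x <= expR x] for [x <= 0]. *)
Lemma expR_le_quad eps l : 0 < eps < 1 -> `|l| <= eps ->
  expR l <= 1 + l + l ^+ 2 / (2 * (1 - eps)).
Proof.
move=> /andP[e0 e1]; rewrite ler_norml => /andP[le1 le2].
have ne : 1 - eps != 0 by rewrite subr_eq0 gt_eqF.
pose f (x : R) : R := 1 + x + x ^+ 2 / (2 * (1 - eps)) - expR x.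
pose df (x : R) : R := 1 + x / (1 - eps) - expR x.
have D x : is_derive x 1 f (df x).
  by apply: is_derive_eq; rewrite /df /GRing.scale /=; field.
suff: f 0 <= f l by rewrite /f expR0; lra.
have [l0|l0] := leP 0 l.
  apply: (derive_ge0_le l0 (fun x _ => D x)) => x /andP[x0 xl].
  have : expR x * (1 - x) <= 1.
    rewrite -[leRHS](expRxMexpNx_1 x).
    by rewrite ler_pM2l ?expR_gt0//; have := expR_ge1Dx (- x); lra.
  have x1 : 0 < 1 - x by lra.
  rewrite -ler_pdivlMr// mul1r => h.
  rewrite subr_ge0 (le_trans h)//.
  have -> : (1 - x)^-1 = 1 + x / (1 - x) by field; lra.
  have h2 : (1 - x)^-1 <= (1 - eps)^-1 by rewrite lef_pV2 ?posrE; lra.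
  by rewrite lerD2l ler_wpM2l.
apply: (derive_le0_ge (ltW l0) (fun x _ => D x)) => x /andP[x0 xl].
have := expR_ge1Dx x; suff : x / (1 - eps) <= x by rewrite /df; lra.
by rewrite ler_pdivrMr; nra.
Qed.

(** The second derivative [1 / z] of [z * ln z] is at most [1 / (1 - eps)] for [z >= 1 - eps]; the
    proof works with first derivatives on each side of [z = 1]. *)
Lemma mulr_ln_le_quad eps u : 0 < eps < 1 -> `|u| <= eps ->
  (1 + u) * ln (1 + u) - u <= u ^+ 2 / (2 * (1 - eps)).
Proof.
move=> /andP[e0 e1]; rewrite ler_norml => /andP[ue1 ue2].
have ne : 1 - eps != 0 by rewrite subr_eq0 gt_eqF.
pose f (z : R) : R := (z - 1) ^+ 2 / (2 * (1 - eps)) - z * ln z + (z - 1).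
pose df (z : R) : R := (z - 1) / (1 - eps) - ln z.
have D (z : R) : 0 < z -> is_derive z 1 f (df z).
  move=> z0; have L := is_derive1_ln z0.
  apply: is_derive_eq; rewrite /df /GRing.scale /=; field.
  by rewrite ne gt_eqF.
suff: f 1 <= f (1 + u).
  rewrite /f ln1 (_ : 1 + u - 1 = u); last by ring.
  by lra.
have [u0|u0] := leP 0 u.
  have u1 : 1 <= 1 + u by lra.
  apply: (@derive_ge0_le f df _ _ u1) => z /andP[z1 z2]; first by apply: D; lra.
  have : ln (1 + (z - 1)) <= z - 1 by apply: le_ln1Dx; lra.
  rewrite addrC subrK; suff : z - 1 <= (z - 1) / (1 - eps) by rewrite /df; lra.
  by rewrite ler_pdivlMr; nra.
have u1 : 1 + u <= 1 by lra.
apply: (@derive_le0_ge f df _ _ u1) => z /andP[z1 z2]; first by apply: D; lra.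
have z0 : 0 < z by lra.
have : - ln z <= (1 - z) / z.
  rewrite -lnV ?posrE//.
  rewrite (_ : ln z^-1 = ln (1 + (1 - z) / z)); last by congr ln; field; lra.
  by apply: le_ln1Dx; rewrite ltr_pdivlMr; lra.
suff : (1 - z) / z <= - ((z - 1) / (1 - eps)) by rewrite /df; lra.
have h2 : z^-1 <= (1 - eps)^-1 by rewrite lef_pV2 ?posrE; lra.
by rewrite -mulNr opprB ler_wpM2l//; lra.
Qed.

(** This is [ln x <= x - 1] at [x = sqrt (v / N)]. Summed over the letters, the terms [N - v] cancel
    and a Kullback-Leibler divergence dominates twice a squared Hellinger distance. *)
Lemma mulr_ln_sqrt_ge (N v : R) : 0 <= N -> 0 < v ->
  (Num.sqrt N - Num.sqrt v) ^+ 2 + (N - v) <= N * ln (N / v).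
Proof.
rewrite le_eqVlt => /predU1P[<-|N0] v0.
  by rewrite !mul0r sqrtr0 !sub0r sqrrN sqr_sqrtr ?subrr ?(ltW v0).
set a := Num.sqrt N; set b := Num.sqrt v.
have a0 : 0 < a by rewrite sqrtr_gt0.
have b0 : 0 < b by rewrite sqrtr_gt0.
have <- : a ^+ 2 = N by rewrite sqr_sqrtr ?ltW.
have <- : b ^+ 2 = v by rewrite sqr_sqrtr ?ltW.
have ba : ln (b / a) <= b / a - 1.
  have {1}-> : b / a = 1 + (b / a - 1) by ring.
  by apply: le_ln1Dx; have := divr_gt0 b0 a0; lra.
have -> : a ^+ 2 / b ^+ 2 = (b / a) ^- 2 by field; rewrite ?gt_eqF.
rewrite lnV ?posrE ?exprn_gt0 ?divr_gt0// lnXn ?divr_gt0//.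
have : a ^+ 2 * ln (b / a) <= a ^+ 2 * (b / a - 1).
  by rewrite ler_wpM2l ?exprn_ge0 ?(ltW a0).
have -> : a ^+ 2 * (b / a - 1) = a * b - a ^+ 2 by field; rewrite gt_eqF.
rewrite mulrN mulrnAr; lra.
Qed.

(* Compares a telescoping sum of increments of [expR (s x) - 1 - s x] against
   the tail [expR (- a x)] with the primitive of the product. *)
Lemma expR_increment_le a s x y : 0 <= s < a -> 0 <= x <= y ->
  ((expR (s * y) - s * y) - (expR (s * x) - s * x)) * expR (- (a * y)) <=
  s * (expR (- ((a - s) * x)) / (a - s) - expR (- (a * x)) / a) -
  s * (expR (- ((a - s) * y)) / (a - s) - expR (- (a * y)) / a).
Proof.
move=> /andP[s0 sa] /andP[x0 xy].
have a0 : a != 0 by rewrite gt_eqF; lra.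
have as0 : a - s != 0 by rewrite gt_eqF; lra.
(* The claim amounts to [f x <= f y]. The derivative factors into [s], [expR (s * z) - 1] and
   [expR (- a * z) - expR (- a * y)], all nonnegative for [0 <= z <= y]. *)
pose f (z : R) : R := - (s * (expR (- (a - s) * z) / (a - s) - expR ((- a) * z) / a))
  - (expR (s * z) - s * z) * expR (- (a * y)).
pose df (z : R) : R := s * (expR (s * z) - 1) * (expR (- a * z) - expR (- a * y)).
have D (z : R) : is_derive z 1 f (df z).
  have E c : is_derive z 1 (fun t : R => expR (c * t)) (c * expR (c * z)).
    have H : is_derive z 1 (fun t : R => c * t) c.
      by apply: is_derive_eq; rewrite /GRing.scale /= mulr1.
    have := @is_derive1_comp R expR (fun t : R => c * t) z _ _ (is_derive_expR _) H.
    by rewrite /comp => {}H; apply: is_derive_eq; rewrite mulrC.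
  have lin (g1 g2 g3 : R -> R) (d1 d2 d3 k : R) : is_derive z 1 g1 d1 ->
      is_derive z 1 g2 d2 -> is_derive z 1 g3 d3 ->
      is_derive z 1 (fun z => - (s * (g1 z / (a - s) - g2 z / a)) -
        (g3 z - s * z) * k) (- (s * (d1 / (a - s) - d2 / a)) - (d3 - s) * k).
    move=> D1 D2 D3; apply: is_derive_eq; rewrite /GRing.scale /=; ring.
  rewrite (_ : df z = - (s * (- (a - s) * expR (- (a - s) * z) / (a - s)
    - - a * expR (- a * z) / a)) - (s * expR (s * z) - s) * expR (- (a * y))).
    by apply: lin; exact: E.
  rewrite /df (_ : - (a - s) * z = s * z + (- a * z)); last by ring.
  by rewrite expRD -(mulNr a y); field; rewrite a0 as0.
suff: f x <= f y by rewrite /f !mulNr; lra.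
apply: (derive_ge0_le xy (fun z _ => D z)) => z /andP[xz zy].
rewrite mulr_ge0// ?mulr_ge0//.
  by rewrite subr_ge0 -expR0 ler_expR mulr_ge0// (le_trans x0).
by rewrite subr_ge0 ler_expR !mulNr lerN2 ler_wpM2l// ltW// (le_lt_trans s0).
Qed.

(** Jensen's inequality for the mean of the numbers [r * x i], obtained by summing the tangent line
    bounds of [expR] at [S]. *)
Lemma exp_convex_ord (r : nat) (x : 'I_r -> R) : (0 < r)%N ->
  expR (\sum_i x i) <= r%:R^-1 * \sum_i expR (r%:R * x i).
Proof.
move=> r0; have rR : 0 < r%:R :> R by rewrite ltr0n.
rewrite ler_pdivlMl//; set S := \sum_i x i.
have -> : r%:R * expR S = \sum_(i < r) (expR S * (1 + (r%:R * x i - S))).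
  rewrite -mulr_sumr big_split/= sumrB -mulr_sumr -/S !sumr_const !card_ord.
  by rewrite -(mulr_natl S); ring.
apply: ler_sum => i _; have := expR_ge1Dx (r%:R * x i - S).
by rewrite -(ler_pM2l (expR_gt0 S)) -expRD (addrC S) subrK.
Qed.

End RealBounds.

(** * Product laws on a finite sample space *)

Section ProductSpace.
Variables (R : realType) (n r : nat).
Local Notation sample := {ffun 'I_n -> 'I_r}.
Implicit Types (f g : sample -> R) (y : sample) (J : {set 'I_n}).

Definition sample_weight (s : 'I_n -> 'I_r -> R) y : R := \prod_t s t (y t).

(** Expectation under the product law with marginals [s], kept as a finite sum so that integration
    enters only in the final reduction. *)
Definition esp (s : 'I_n -> 'I_r -> R) f : R := \sum_y sample_weight s y * f y.

Definition determined_by J f : Prop :=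
  forall y y', (forall t, t \in J -> y t = y' t) -> f y = f y'.

Variable s : 'I_n -> 'I_r -> R.

Lemma esp_sum (I : Type) (l : seq I) (p : pred I) (F : I -> sample -> R) :
  esp s (fun y => \sum_(i <- l | p i) F i y) = \sum_(i <- l | p i) esp s (F i).
Proof. by rewrite exchange_big; apply: eq_bigr => y _; rewrite mulr_sumr. Qed.

Lemma espD f g : esp s (fun y => f y + g y) = esp s f + esp s g.
Proof. by rewrite -big_split; apply: eq_bigr => y _; rewrite mulrDr. Qed.

Lemma espZ (c : R) f : esp s (fun y => c * f y) = c * esp s f.
Proof. by rewrite mulr_sumr; apply: eq_bigr => y _; rewrite mulrCA. Qed.

Lemma eq_esp f g : f =1 g -> esp s f = esp s g.
Proof. by move=> fg; apply: eq_bigr => y _; rewrite fg. Qed.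

Lemma esp_prod (F : 'I_n -> 'I_r -> R) :
  esp s (fun y => \prod_t F t (y t)) = \prod_t \sum_i s t i * F t i.
Proof.
by rewrite bigA_distr_bigA; apply: eq_bigr => y _; rewrite -big_split.
Qed.

Hypothesis s_ge0 : forall t i, 0 <= s t i.
Hypothesis s_sum1 : forall t, \sum_i s t i = 1.

Lemma sample_weight_ge0 y : 0 <= sample_weight s y.
Proof. exact: prodr_ge0. Qed.

Lemma ler_esp f g : (forall y, f y <= g y) -> esp s f <= esp s g.
Proof.
by move=> fg; apply: ler_sum => y _; rewrite ler_wpM2l// sample_weight_ge0.
Qed.

Lemma esp_cst (c : R) : esp s (fun=> c) = c.
Proof.
have /= := esp_prod (fun _ _ => 1).
rewrite [RHS]big1 => [|t _]; last by under eq_bigr do rewrite mulr1.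
move=> e; rewrite /esp -mulr_suml -[RHS]mul1r -e; congr (_ * c).
by apply: eq_bigr => y _; rewrite big1 ?mulr1.
Qed.

Lemma esp_coord (t : 'I_n) (F : 'I_r -> R) :
  esp s (fun y => F (y t)) = \sum_i s t i * F i.
Proof.
pose G t' i := if t' == t then F i else 1.
rewrite (@eq_esp _ (fun y => \prod_t' G t' (y t'))) => [|y].
  rewrite esp_prod (bigD1 t)//= [X in _ * X]big1 /G ?eqxx ?mulr1// => t' /negPf->.
  by under eq_bigr do rewrite mulr1.
by rewrite (bigD1 t)//= /G eqxx big1 ?mulr1// => t' /negPf->.
Qed.

(* Exchanging the coordinates outside J between two independent copies of the
   sample preserves their joint law and turns f(y) g(y') into f(y) g(y). *)
Lemma espM_disjoint J1 J2 f g : [disjoint J1 & J2] ->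
  determined_by J1 f -> determined_by J2 g ->
  esp s (fun y => f y * g y) = esp s f * esp s g.
Proof.
move=> dJ fJ gJ.
pose sw (y y' : sample) : sample := [ffun t => if t \in J1 then y t else y' t].
pose h (p : sample * sample) := (sw p.1 p.2, sw p.2 p.1).
have hK : involutive h.
  move=> [y y']; rewrite /h /=; congr pair; apply/ffunP => t; rewrite !ffunE;
    by case: ifP => tJ; rewrite ?ffunE ?tJ.
have wE y y' : sample_weight s (sw y y') * sample_weight s (sw y' y)
             = sample_weight s y * sample_weight s y'.
  rewrite -!big_split; apply: eq_bigr => t _ /=; rewrite !ffunE.
  by case: ifP => //; rewrite mulrC.
rewrite [RHS]big_distrlr /= pair_bigA /= (reindex_inj (inv_inj hK)) /=.
rewrite -(pair_bigA _ (fun y y' => sample_weight s (sw y y') * f (sw y y') *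
  (sample_weight s (sw y' y) * g (sw y' y)))) /=.
apply: eq_bigr => y _; symmetry.
rewrite -[RHS]mulr1 -[X in _ = _ * X](esp_cst 1) [RHS]mulr_sumr.
apply: eq_bigr => y' _; rewrite mulrACA wE.
rewrite (fJ (sw y y') y) => [|t tJ]; last by rewrite ffunE tJ.
rewrite (gJ (sw y' y) y) => [|t tJ]; last first.
  by rewrite ffunE (disjointFl dJ tJ).
by rewrite mulr1 mulrAC.
Qed.

Lemma esp_prod_trivIset (m : {set {set 'I_n}}) (F : {set 'I_n} -> sample -> R) :
  finset.trivIset m -> (forall J, J \in m -> determined_by J (F J)) ->
  esp s (fun y => \prod_(J in m) F J y) = \prod_(J in m) esp s (F J).
Proof.
move=> /finset.trivIsetP tm Fm.
have [l ul ml] : exists2 l, uniq l & m =i l.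
  by exists (enum m); [exact: enum_uniq|move=> J; rewrite mem_enum].
have lm : {subset l <= m} by move=> J; rewrite ml.
have -> : \prod_(J in m) esp s (F J) = \prod_(J <- l) esp s (F J).
  by rewrite (eq_bigl _ _ ml) big_uniq.
rewrite (@eq_esp _ (fun y => \prod_(J <- l) F J y)); last first.
  by move=> y; rewrite (eq_bigl _ _ ml) big_uniq.
elim: l ul lm {ml} => [_ _|J l IH /= /andP[Jl ul] lm].
  by rewrite big_nil (@eq_esp _ (fun=> 1)) ?esp_cst// => y; rewrite big_nil.
have lm' : {subset l <= m} by move=> K Kl; apply: lm; rewrite inE Kl orbT.
rewrite big_cons -IH//; under eq_esp do rewrite big_cons.
(* The product over the remaining blocks depends only on coordinates outside [J]. *)
apply: (@espM_disjoint J (~: J)).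
- by rewrite finset.disjoints_subset finset.setCK.
- by apply: Fm; apply: lm; rewrite mem_head.
move=> y y' yy'; rewrite !big_seq; apply: eq_bigr => K Kl.
apply: Fm; first exact: lm'.
move=> t tK; apply: yy'; rewrite inE.
have JK : K != J by apply: contraNneq Jl => <-.
by rewrite (disjointFr (tm _ _ (lm' _ Kl) (lm _ (mem_head _ _)) JK) tK).
Qed.

End ProductSpace.

(** * Deviations of the counts *)

Section Deviations.
Variables (R : realType) (n r : nat) (s : 'I_n -> 'I_r -> R).
Local Notation sample := {ffun 'I_n -> 'I_r}.
Implicit Types (J : {set 'I_n}) (i : 'I_r).

Definition count_in (y : 'I_n -> 'I_r) J i : R := \sum_(t in J) (y t == i)%:R.
Definition mass J i : R := \sum_(t in J) s t i.
Definition deviation (y : 'I_n -> 'I_r) J i : R := count_in y J i - mass J i.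

Hypothesis s_ge0 : forall t i, 0 <= s t i.
Hypothesis s_sum1 : forall t, \sum_i s t i = 1.

Lemma deviationE (y : 'I_n -> 'I_r) J i :
  deviation y J i = \sum_(t in J) ((y t == i)%:R - s t i).
Proof. by rewrite sumrB. Qed.

Lemma mass_ge0 J i : 0 <= mass J i.
Proof. exact: sumr_ge0. Qed.

(** The factors over [t] are independent, and [1 + u <= expR u] replaces each Bernoulli moment by a
    Poisson one. *)
Lemma esp_expR_deviation J i (l : R) :
  esp s (fun y => expR (l * deviation y J i)) <=
  expR (mass J i * (expR l - 1 - l)).
Proof.
pose F t j := if t \in J then expR (l * ((j == i)%:R - s t i)) else 1.
rewrite (@eq_esp _ _ _ _ _ (fun y => \prod_t F t (y t))) => [|y].
  rewrite esp_prod /mass mulr_suml expR_sum [leRHS]big_mkcond.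
  apply: ler_prod => t _; rewrite sumr_ge0/=; last first.
    by move=> j _; rewrite mulr_ge0// /F; case: ifP => // _; exact: expR_ge0.
  rewrite /F; case: ifP => tJ; last by under eq_bigr do rewrite mulr1; rewrite s_sum1.
  under eq_bigr do rewrite mulrBr expRB mulrA.
  rewrite -mulr_suml.
  have -> : \sum_j s t j * expR (l * (j == i)%:R) = 1 + s t i * (expR l - 1).
    have := s_sum1 t; rewrite (bigD1 i)//= => st1.
    rewrite (bigD1 i)//= eqxx mulr1.
    rewrite (eq_bigr (s t)) => [|j /negPf->]; last by rewrite mulr0 expR0 mulr1.
    lra.
  have -> : s t i * (expR l - 1 - l) = s t i * (expR l - 1) - l * s t i by ring.
  by rewrite expRB ler_pM2r ?invr_gt0 ?expR_gt0// expR_ge1Dx.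
rewrite deviationE mulr_sumr expR_sum big_mkcond; apply: eq_bigr => t _.
by rewrite /F; case: ifP.
Qed.

(** Chernoff bound at [l = (1 - eps) * x / v], the minimiser of
    [v * l ^+ 2 / (2 * (1 - eps)) - l * x] for [v = mass J i]. The restriction on [x] keeps [l] in
    the range of [expR_le_quad]; the factor 2 accounts for both signs. *)
Lemma deviation_tail (eps x : R) J i : 0 < eps < 1 -> 0 < mass J i ->
  0 <= x <= eps * mass J i ->
  esp s (fun y => (x <= `|deviation y J i|)%R%:R) <=
  2 * expR (- ((1 - eps) * x ^+ 2 / (2 * mass J i))).
Proof.
move=> /andP[e0 e1] v0 /andP[x0 xe]; set v := mass J i in v0 xe *.
set B := expR _; pose l := (1 - eps) * x / v.
have l0 : 0 <= l by apply: divr_ge0; [apply: mulr_ge0; lra|exact: ltW].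
have le : `|l| <= eps.
  by rewrite ger0_norm// ler_pdivrMr// (le_trans _ xe)//; nra.
have H (c : R) : `|c| = 1 ->
    esp s (fun y => expR (c * l * deviation y J i)) * expR (- (l * x)) <= B.
  move=> c1; rewrite -ler_pdivlMr ?expR_gt0//.
  apply: le_trans (esp_expR_deviation _ _ _) _.
  rewrite /B -expRB ler_expR.
  have cl : `|c * l| <= eps by rewrite normrM c1 mul1r.
  have e01 : 0 < eps < 1 by rewrite e0.
  have := expR_le_quad e01 cl; have -> : (c * l) ^+ 2 = l ^+ 2.
    by rewrite exprMn -[c ^+ 2]real_normK ?num_real// c1 expr1n mul1r.
  move=> h; apply: le_trans (_ : v * (l ^+ 2 / (2 * (1 - eps))) <= _).
    by rewrite ler_pM2l//; lra.
  rewrite le_eqVlt; apply/orP; left; apply/eqP; rewrite /l; field.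
  by rewrite gt_eqF//= subr_eq0 gt_eqF.
apply: le_trans (_ :
  esp s (fun y => expR (1 * l * deviation y J i)) * expR (- (l * x)) +
  esp s (fun y => expR (- 1 * l * deviation y J i)) * expR (- (l * x)) <= _);
  last first.
  by rewrite mulr_natl mulr2n lerD// H// ?normrN normr1.
rewrite -mulrDl -espD mulrC -espZ; apply: ler_esp => // y.
rewrite mulrDr -!expRD; have [xd|_] := leP x; last by rewrite addr_ge0 ?expR_ge0.
move: xd; rewrite ler_normr => /orP[xd|xd].
  apply: le_trans (_ : expR (- (l * x) + 1 * l * deviation y J i) <= _);
    last by rewrite lerDl expR_ge0.
  by rewrite -[leLHS]expR0 ler_expR mul1r addrC subr_ge0 ler_wpM2l.
apply: le_trans (_ : expR (- (l * x) + -1 * l * deviation y J i) <= _);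
  last by rewrite lerDr expR_ge0.
by rewrite -[leLHS]expR0 ler_expR mulN1r mulNr addrC subr_ge0 -mulrN ler_wpM2l.
Qed.

(** Cross terms vanish by independence and centring; the diagonal consists of Bernoulli variances
    [p - p ^+ 2 <= p]. *)
Lemma esp_sqr_deviation J i : esp s (fun y => deviation y J i ^+ 2) <= mass J i.
Proof.
pose xi t y : R := (y t == i)%:R - s t i.
have E1 t : esp s (fun y => xi t y) = 0.
  rewrite (esp_coord s_sum1 t (fun j => (j == i)%:R - s t i)).
  under eq_bigr do rewrite mulrBr.
  rewrite sumrB -mulr_suml s_sum1 mul1r (bigD1 i)//= eqxx mulr1 big1 ?addr0 ?subrr//.
  by move=> j /negPf->; rewrite mulr0.
rewrite (@eq_esp _ _ _ _ _
  (fun y => \sum_(t in J) \sum_(t' in J) xi t y * xi t' y)); last first.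
  by move=> y; rewrite deviationE expr2 big_distrlr.
rewrite esp_sum /mass; apply: ler_sum => t tJ.
rewrite esp_sum (bigD1 t)//= [X in _ + X]big1 ?addr0.
  rewrite (esp_coord s_sum1 t (fun j => ((j == i)%:R - s t i) * ((j == i)%:R - s t i))).
  rewrite (eq_bigr (fun j =>
    s t j * (s t i ^+ 2) + (j == i)%:R * (s t i * (1 - 2 * s t i)))).
    rewrite big_split/= -!mulr_suml s_sum1 (bigD1 i)//= eqxx big1 => [|j /negPf->//].
    by rewrite [true%:R]/= addr0; have := sqr_ge0 (s t i); nra.
  by move=> j _; have [->|_] := eqVneq j i; rewrite /=; ring.
move=> t' /andP[t'J t't].
rewrite (@espM_disjoint _ _ _ s s_sum1 [set t]%SET [set t']%SET) ?E1 ?mul0r//.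
- by rewrite disjoints1 inE eq_sym.
- by move=> y y' yy'; rewrite /xi yy'// inE.
- by move=> y y' yy'; rewrite /xi yy'// inE.
Qed.

End Deviations.

(** * Exponential moments of the squared deviations *)

Section ExponentialMoments.
Variables (R : realType) (n r : nat) (s : 'I_n -> 'I_r -> R).
Local Notation sample := {ffun 'I_n -> 'I_r}.
Implicit Types (J : {set 'I_n}) (i : 'I_r).

Hypothesis s_ge0 : forall t i, 0 <= s t i.
Hypothesis s_sum1 : forall t, \sum_i s t i = 1.

(** The affine part of the exponential is split off because its mean is bounded sharply by the
    variance; the cruder tail bounds enter only through this remainder, of order [c ^+ 2]. *)
Definition expR_rem2 (c x : R) : R := expR (c * x) - 1 - c * x.

Lemma expR_rem2_nd (c x y : R) : 0 <= c -> 0 <= x <= y ->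
  expR_rem2 c x <= expR_rem2 c y.
Proof.
move=> c0 /andP[x0 xy]; rewrite /expR_rem2.
have := expR_ge1Dx (c * (y - x)); have : 1 <= expR (c * x).
  by rewrite -expR0 ler_expR mulr_ge0.
have -> : c * y = c * x + c * (y - x) by ring.
rewrite expRD; set a := expR _; set b := expR _; set d := c * (y - x).
have d0 : 0 <= d by rewrite mulr_ge0// subr_ge0.
nra.
Qed.

(* A discrete layer cake formula, applied below on a mesh of step 1/4. *)
Lemma layer_cake_le (g : R -> R) (delta : R) (N : nat) (k : R) :
  (forall x y, 0 <= x <= y -> g x <= g y) -> g 0 = 0 -> 0 <= delta ->
  0 <= k <= delta * N%:R ->
  g k <= \sum_(j < N)
     (g (delta * j.+1%:R) - g (delta * j%:R)) * (delta * j%:R <= k)%R%:R.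
Proof.
move=> gnd g0 d0; elim: N => [|N IH] /andP[k0 kN].
  by rewrite big_ord0 -g0 gnd// k0 -(mulr0 delta).
rewrite big_ord_recr/=; have [kN'|kN'] := leP k (delta * N%:R).
  rewrite -[leLHS]addr0 lerD ?IH ?k0// mulr_ge0// subr_ge0 gnd//.
  by rewrite mulr_ge0//= ler_wpM2l// ler_nat.
rewrite (ltW kN') mulr1 (eq_bigr (fun j : 'I_N =>
    g (delta * j.+1%:R) - g (delta * j%:R))) => [|j _]; last first.
  by rewrite (le_trans _ (ltW kN')) ?mulr1// ler_wpM2l// ler_nat ltnW.
rewrite -(big_mkord xpredT (fun j => g (delta * j.+1%:R) - g (delta * j%:R))).
rewrite telescope_sumr// mulr0 g0 subr0 addrC subrK.
by rewrite gnd// k0.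
Qed.

(** The layer cake sum is compared with the integral over [z >= 0] of the derivative of
    [expR_rem2 c] against [expR (- (a * z))], which equals [c ^+ 2 / (a * (a - c))]. *)
Lemma esp_expR_rem2 (b : pred sample) (k : sample -> R) (c : R) :
  (forall y, 0 <= k y) ->
  (forall z, 0 <= z ->
    esp s (fun y => (b y && (z <= k y))%:R) <= 2 * expR (- (9 / 10 * z))) ->
  0 <= c <= 1 / 7 ->
  esp s (fun y => (b y)%:R * expR_rem2 c (k y)) <= 4 * c ^+ 2.
Proof.
move=> k0 ktail /andP[c0 c7].
pose a : R := 9 / 10; pose d : R := 4^-1.
have gnd x y : 0 <= x <= y -> expR_rem2 c x <= expR_rem2 c y.
  exact: expR_rem2_nd.
have g0 : expR_rem2 c 0 = 0 by rewrite /expR_rem2 mulr0 expR0; ring.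
have d0 : 0 <= d by rewrite /d; lra.
(* The sample space is finite, so finitely many mesh levels reach the maximum of [k]. *)
have [N kN] : exists N : nat, forall y, k y <= d * N%:R.
  exists (Num.truncn (4 * \sum_y k y)).+1 => y.
  have : k y <= \sum_y k y by rewrite (bigD1 y)//= lerDl sumr_ge0.
  have := truncnS_gt (4 * \sum_y k y); rewrite /d; lra.
pose dg (j : nat) := expR_rem2 c (d * j.+1%:R) - expR_rem2 c (d * j%:R).
pose H x := c * (expR (- ((a - c) * x)) / (a - c) - expR (- (a * x)) / a).
have dg0 j : 0 <= dg j.
  by rewrite subr_ge0 gnd// mulr_ge0//= ler_wpM2l// ler_nat.
(* The price of passing from the tail at the left end of a mesh cell, as in the layer cake, to the
   one at its right end, as in [expR_increment_le]. *)
have ea : expR (a * d) <= 13 / 10.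
  have -> : expR (a * d) = (expR (- (a * d)))^-1 by rewrite expRN invrK.
  have := expR_ge1Dx (- (a * d)); rewrite /a /d => h.
  by rewrite -[leRHS]invrK lef_pV2 ?posrE ?expR_gt0//; lra.
apply: le_trans (_ : \sum_(j < N) dg j * (2 * expR (- (a * (d * j%:R)))) <= _).
  apply: le_trans (_ : esp s (fun y => \sum_(j < N)
     dg j * (b y && (d * j%:R <= k y))%:R) <= _).
    apply: ler_esp => // y; case: (b y); rewrite ?mul1r ?mul0r /=.
      by apply: layer_cake_le; rewrite // k0 kN.
    by apply: sumr_ge0 => j _; rewrite mulr0.
  rewrite esp_sum; apply: ler_sum => j _; rewrite espZ ler_wpM2l// ktail//.
  by rewrite mulr_ge0.
have Hj (j : nat) : dg j * (2 * expR (- (a * (d * j%:R)))) <=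
    2 * (13 / 10) * (H (d * j%:R) - H (d * j.+1%:R)).
  have ca : 0 <= c < a by rewrite /a; lra.
  have dj : 0 <= d * j%:R <= d * j.+1%:R.
    by rewrite mulr_ge0//= ler_wpM2l// ler_nat.
  have := expR_increment_le ca dj; rewrite -/(H _) -/(H _).
  have -> : - (a * (d * j%:R)) = a * d - a * (d * j.+1%:R).
    by rewrite -natr1; ring.
  rewrite expRD.
  have -> : expR (c * (d * j.+1%:R)) - c * (d * j.+1%:R) -
      (expR (c * (d * j%:R)) - c * (d * j%:R)) = dg j.
    by rewrite /dg /expR_rem2; ring.
  set E := expR (- _); set E' := expR (a * d) in ea *; set h := _ - _.
  move=> hh; apply: le_trans (_ : 2 * (E' * (dg j * E)) <= _).
    by rewrite le_eqVlt; apply/orP; left; apply/eqP; ring.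
  rewrite -mulrA ler_pM2l// ler_pM//; first exact: expR_ge0.
  by rewrite mulr_ge0// expR_ge0.
apply: le_trans (ler_sum _ (fun (j : 'I_N) _ => Hj j)) _.
rewrite -mulr_sumr -(big_mkord xpredT (fun j => H (d * j%:R) - H (d * j.+1%:R))).
rewrite (@telescope_sumr_eq _ _ _ (fun j => - H (d * j%:R))) => [|//|i _]; last first.
  by rewrite opprK addrC.
rewrite mulr0 opprK addrC; set x := d * N%:R.
have x0 : 0 <= x by rewrite mulr_ge0.
have ac0 : 0 < a - c by rewrite /a; lra.
have a0 : 0 < a by rewrite /a; lra.
have H0 : 0 <= H x.
  rewrite mulr_ge0// subr_ge0 ler_pM ?invr_ge0 ?expR_ge0//; first exact: ltW.
    by rewrite ler_expR lerN2 ler_wpM2r//; lra.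
  by rewrite lef_pV2 ?posrE//; lra.
have -> : H 0 = c ^+ 2 / (a * (a - c)).
  by rewrite /H !mulr0 oppr0 expR0; field; rewrite !gt_eqF.
apply: le_trans (_ : 2 * (13 / 10) * (c ^+ 2 / (a * (a - c))) <= _).
  by rewrite ler_pM2l ?gerBl//; lra.
(* For [c <= 1 / 7] the factor of [c ^+ 2] is at most about 3.82. *)
rewrite (_ : _ * _ = 2 * (13 / 10) / (a * (a - c)) * c ^+ 2); last by ring.
by rewrite ler_wpM2r ?sqr_ge0// ler_pdivrMr ?mulr_gt0// /a; lra.
Qed.

(** A chi-square term, normalised so as to bound the contribution of the letter [i] to a
    Kullback-Leibler divergence when the count is within a factor [1 +- eps] of its mean. *)
Definition scaled_deviation (eps : R) (y : 'I_n -> 'I_r) J i : R :=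
  deviation s y J i ^+ 2 / (2 * (1 - eps) * mass s J i).

Lemma scaled_deviation_ge0 (eps : R) y J i : eps < 1 ->
  0 <= scaled_deviation eps y J i.
Proof.
by move=> e1; rewrite divr_ge0 ?sqr_ge0// mulr_ge0 ?mass_ge0// mulr_ge0// subr_ge0 ltW.
Qed.

(** For [x ^+ 2 = 2 * (1 - eps) * v * z], [deviation_tail] yields the exponent [(1 - eps) ^+ 2 * z],
    and [eps <= 1 / 20] makes the factor at least [9 / 10]. If [x > eps * v] the event is empty. *)
Lemma scaled_deviation_tail (eps z : R) J i :
  0 < eps <= 1 / 20 -> 0 < mass s J i -> 0 <= z ->
  esp s (fun y => ((`|deviation s y J i| <= eps * mass s J i) &&
     (z <= scaled_deviation eps y J i))%R%:R) <= 2 * expR (- (9 / 10 * z)).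
Proof.
move=> /andP[e0 e20] v0 z0; set v := mass s J i in v0 *.
pose x := Num.sqrt (2 * (1 - eps) * v * z).
have c0 : 0 < 2 * (1 - eps) * v by rewrite !mulr_gt0//; lra.
have x2 : x ^+ 2 = 2 * (1 - eps) * v * z.
  by rewrite sqr_sqrtr// mulr_ge0// ltW.
have zx y : (z <= scaled_deviation eps y J i) = (x <= `|deviation s y J i|).
  rewrite /scaled_deviation ler_pdivlMr// -/v (mulrC z) -x2.
  rewrite -(real_normK (num_real (deviation _ _ _ _))).
  by rewrite ler_pXn2r ?nnegrE ?sqrtr_ge0.
have e01 : 0 < eps < 1 by lra.
have [xe|xe] := leP x (eps * v).
  apply: le_trans (_ : esp s (fun y => (x <= `|deviation s y J i|)%R%:R) <= _).
    apply: ler_esp => // y; rewrite zx ler_nat.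
    by case: (x <= _); rewrite ?andbF// andbT leq_b1.
  apply: le_trans (deviation_tail s_ge0 s_sum1 e01 v0 _) _.
    by rewrite xe sqrtr_ge0.
  rewrite ler_pM2l// ler_expR lerN2 -/v x2.
  have -> : (1 - eps) * (2 * (1 - eps) * v * z) / (2 * v) = (1 - eps) ^+ 2 * z.
    by field; rewrite gt_eqF.
  by rewrite ler_wpM2r//; nra.
rewrite (@eq_esp _ _ _ _ _ (fun=> 0)) => [|y].
  by rewrite esp_cst// mulr_ge0// expR_ge0.
rewrite zx; case: (leP x _) => [xd|_]; last by rewrite andbF.
by rewrite andbT leNgt (lt_le_trans xe xd).
Qed.

Lemma esp_expR_scaled_deviation (eps c : R) J i :
  0 < eps <= 1 / 20 -> 0 < mass s J i -> 0 <= c <= 1 / 7 ->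
  esp s (fun y => (`|deviation s y J i| <= eps * mass s J i)%R%:R *
     expR (c * scaled_deviation eps y J i)) <=
  expR (c / (2 * (1 - eps)) + 4 * c ^+ 2).
Proof.
move=> e20 v0 c7; have e1 : eps < 1 by lra.
have c0 : 0 <= c by lra.
set v := mass s J i in v0 *.
pose b (y : sample) := `|deviation s y J i| <= eps * v.
pose k (y : sample) := scaled_deviation eps y J i.
have k0 y : 0 <= k y by exact: scaled_deviation_ge0.
have kt z : 0 <= z ->
    esp s (fun y => (b y && (z <= k y))%:R) <= 2 * expR (- (9 / 10 * z)).
  exact: scaled_deviation_tail.
have := esp_expR_rem2 k0 kt c7 => rem2.
have e0 : 0 < 2 * (1 - eps) by lra.
have Ek : esp s k <= 1 / (2 * (1 - eps)).
  rewrite (@eq_esp _ _ _ _ _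
    (fun y => (2 * (1 - eps) * v)^-1 * deviation s y J i ^+ 2)); last first.
    by move=> y; rewrite mulrC.
  rewrite espZ; apply: le_trans (_ : (2 * (1 - eps) * v)^-1 * v <= _).
    by rewrite ler_wpM2l ?esp_sqr_deviation// invr_ge0 ltW// mulr_gt0.
  by rewrite le_eqVlt; apply/orP; left; apply/eqP; field; rewrite !gt_eqF//; lra.
(* The indicator is dropped from the nonnegative linear part, controlled by the variance, and kept
   on the remainder, whose tail bound holds on the event only. *)
apply: le_trans (_ :
  esp s (fun y => 1 + (c * k y + (b y)%:R * expR_rem2 c (k y))) <= _).
  apply: ler_esp => // y; rewrite -/(b y) -/(k y) /expR_rem2.
  have ck0 : 0 <= c * k y by exact: mulr_ge0.
  by case: (b y); rewrite /= ?mulr1n ?mulr0n ?mul1r ?mul0r; lra.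
rewrite !espD esp_cst// espZ; apply: le_trans (expR_ge1Dx _).
by rewrite lerD2l lerD// -div1r mulrCA mul1r ler_wpM2l// -div1r.
Qed.

End ExponentialMoments.

(** * Divergence on a segment *)

Section SegmentDivergence.
Variables (R : realType) (n r : nat) (s : 'I_n -> 'I_r -> R).
Local Notation sample := {ffun 'I_n -> 'I_r}.
Implicit Types (J : {set 'I_n}) (m mf : {set {set 'I_n}}) (i : 'I_r).

Hypothesis s_gt0 : forall t i, 0 < s t i.
Hypothesis s_sum1 : forall t, \sum_i s t i = 1.

Let s_ge0 t i : 0 <= s t i. Proof. exact: ltW. Qed.

(* |J| times the Kullback-Leibler divergence between the values of the
   estimator and of the projection on the segment J. *)
Definition segment_KL (y : 'I_n -> 'I_r) J : R :=
  \sum_i count_in R y J i * ln (count_in R y J i / mass s J i).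

Definition well_estimated (eps : R) (y : 'I_n -> 'I_r) J : bool :=
  [forall i, `|deviation s y J i| <= eps * mass s J i].

Lemma mass_gt0 J i : J != finset.set0 -> 0 < mass s J i.
Proof.
move=> /set0Pn[t tJ]; rewrite /mass (bigD1 t)//=.
by apply: ltr_pwDl => //; apply: sumr_ge0.
Qed.

Lemma count_in_ge0 (y : 'I_n -> 'I_r) J i : 0 <= count_in R y J i.
Proof. exact: sumr_ge0. Qed.

(** Counts and masses over [J] both sum to the size of [J]. This cancels the linear terms in the
    lower and upper bounds on [segment_KL]. *)
Lemma sum_deviation (y : 'I_n -> 'I_r) J : \sum_i deviation s y J i = 0.
Proof.
rewrite sumrB /count_in /mass exchange_big [X in _ - X]exchange_big /= -sumrB.
apply: big1 => t _; rewrite s_sum1 (bigD1 (y t))//= eqxx big1 ?addr0 ?subrr//.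
by move=> i; rewrite eq_sym => /negPf->.
Qed.

Lemma segment_KL_ge_sqrt (y : 'I_n -> 'I_r) J : J != finset.set0 ->
  \sum_i (Num.sqrt (count_in R y J i) - Num.sqrt (mass s J i)) ^+ 2
  <= segment_KL y J.
Proof.
move=> J0; rewrite -[leLHS]addr0 -[X in _ + X <= _](sum_deviation y J) -big_split /=.
by apply: ler_sum => i _; rewrite mulr_ln_sqrt_ge ?count_in_ge0 ?mass_gt0.
Qed.

Lemma segment_KL_ge0 (y : 'I_n -> 'I_r) J : J != finset.set0 ->
  0 <= segment_KL y J.
Proof.
move=> J0; apply: le_trans (segment_KL_ge_sqrt y J0).
by apply: sumr_ge0 => i _; exact: sqr_ge0.
Qed.

Lemma segment_KL_le eps (y : 'I_n -> 'I_r) J : 0 < eps < 1 ->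
  J != finset.set0 -> well_estimated eps y J ->
  segment_KL y J <= \sum_i scaled_deviation s eps y J i.
Proof.
move=> e01 J0 /forallP yJ.
rewrite /segment_KL -[leRHS]addr0 -[X in _ <= _ + X](sum_deviation y J) -big_split /=.
apply: ler_sum => i _; have := mass_gt0 i J0; have := yJ i.
rewrite /scaled_deviation; set v := mass s J i; set D := deviation _ _ _ _.
have -> : count_in R y J i = v + D by rewrite /D /deviation addrC subrK.
move=> De v0; have e1 : 1 - eps != 0 by rewrite gt_eqF; lra.
have vn : v != 0 by rewrite gt_eqF.
have := @mulr_ln_le_quad _ eps (D / v) e01.
rewrite normrM normfV (gtr0_norm v0) ler_pdivrMr// => /(_ De) h.
have -> : (v + D) / v = 1 + D / v by field.
have -> : (v + D) * ln (1 + D / v) =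
    v * ((1 + D / v) * ln (1 + D / v) - D / v) + D by field.
rewrite lerD2r; apply: le_trans (_ : v * ((D / v) ^+ 2 / (2 * (1 - eps))) <= _).
  by rewrite ler_pM2l.
by rewrite le_eqVlt; apply/orP; left; apply/eqP; field; rewrite ?e1 ?vn.
Qed.

(** Counts of different letters are dependent, so [exp_convex_ord] averages one-letter moments at
    the price of the rate [c / r]; hence the factor [r] in the penalty. *)
Lemma esp_expR_segment_KL eps (c : R) J : (0 < r)%N ->
  0 < eps <= 1 / 20 -> J != finset.set0 -> 0 <= c <= 1 / 7 ->
  esp s (fun y => (well_estimated eps y J)%:R * expR (c / r%:R * segment_KL y J))
  <= expR (c / (2 * (1 - eps)) + 4 * c ^+ 2).
Proof.
move=> r0 e20 J0 c7; have rR : 0 < r%:R :> R by rewrite ltr0n.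
have c0 : 0 <= c by lra.
have e01 : 0 < eps < 1 by lra.
pose g i (y : sample) : R := (`|deviation s y J i| <= eps * mass s J i)%R%:R *
  expR (c * scaled_deviation s eps y J i).
apply: le_trans (_ : esp s (fun y => r%:R^-1 * \sum_i g i y) <= _); last first.
  rewrite espZ esp_sum ler_pdivrMl//.
  have <- : \sum_(i < r) expR (c / (2 * (1 - eps)) + 4 * c ^+ 2) =
      r%:R * expR (c / (2 * (1 - eps)) + 4 * c ^+ 2).
    by rewrite sumr_const card_ord -[LHS]mulr_natl.
  apply: ler_sum => i _.
  by apply: esp_expR_scaled_deviation => //; exact: mass_gt0.
apply: ler_esp => // y; have [yJ|_] := boolP (well_estimated eps y J); last first.
  rewrite mul0r mulr_ge0 ?invr_ge0 ?ler0n//; apply: sumr_ge0 => i _.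
  by rewrite mulr_ge0 ?expR_ge0.
have -> : \sum_i g i y = \sum_i expR (r%:R * (c / r%:R * scaled_deviation s eps y J i)).
  apply: eq_bigr => i _; rewrite /g (forallP yJ i) mul1r; congr expR.
  by field; rewrite gt_eqF.
rewrite mul1r; apply: le_trans (exp_convex_ord _ r0).
by rewrite ler_expR -mulr_sumr ler_wpM2l ?segment_KL_le// divr_ge0// ltW.
Qed.

Lemma determined_by_segment (G : ('I_r -> R) -> R) J :
  determined_by J (fun y : sample => G (count_in R y J)).
Proof.
move=> y y' yy'; congr G; apply/funext => i.
by apply: eq_bigr => t tJ; rewrite yy'.
Qed.

(** The indicator and the exponential both factor over the segments, which involve disjoint sets of
    coordinates. *)
Lemma esp_expR_partition_KL eps (c : R) m : (0 < r)%N ->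
  finset.trivIset m -> (forall J, J \in m -> J != finset.set0) ->
  0 < eps <= 1 / 20 -> 0 <= c <= 1 / 7 ->
  esp s (fun y => [forall J in m, well_estimated eps y J]%:R *
    expR (c / r%:R * \sum_(J in m) segment_KL y J)) <=
  expR (#|m|%:R * (c / (2 * (1 - eps)) + 4 * c ^+ 2)).
Proof.
move=> r0 tm m0 e20 c7.
pose F J (y : sample) := (well_estimated eps y J)%:R * expR (c / r%:R * segment_KL y J).
rewrite (@eq_esp _ _ _ _ _ (fun y => \prod_(J in m) F J y)) => [|y]; last first.
  rewrite big_split/= mulr_sumr expR_sum; congr (_ * _).
  case: (altP forall_inP) => [h|]; first by rewrite big1// => J /h ->.
  rewrite negb_forall_in => /exists_inP[J Jm /negPf yJ].
  by rewrite (bigD1 J)//= yJ mul0r.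
rewrite esp_prod_trivIset//; last first.
  move=> J Jm; pose G (N : 'I_r -> R) : R :=
    [forall i, `|N i - mass s J i| <= eps * mass s J i]%:R *
    expR (c / r%:R * \sum_i N i * ln (N i / mass s J i)).
  exact: (determined_by_segment G).
rewrite expRM_natl -prodr_const; apply: ler_prod => J Jm.
rewrite esp_expR_segment_KL ?m0// andbT; apply: sumr_ge0 => y _.
by rewrite mulr_ge0 ?sample_weight_ge0// mulr_ge0 ?expR_ge0.
Qed.

Lemma deviation_cover (y : 'I_n -> 'I_r) (B : {set {set 'I_n}}) i :
  finset.trivIset B ->
  deviation s y (finset.cover B) i = \sum_(J in B) deviation s y J i.
Proof.
move=> tB; rewrite deviationE finset.big_trivIset//=.
by apply: eq_bigr => J _; rewrite deviationE.
Qed.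

(** Deviations and masses are additive over disjoint blocks, so a single event on [mf] serves every
    partition constructed on it. *)
Lemma well_estimated_cover eps (y : 'I_n -> 'I_r) (B : {set {set 'I_n}}) :
  finset.trivIset B -> (forall J, J \in B -> well_estimated eps y J) ->
  well_estimated eps y (finset.cover B).
Proof.
move=> tB yB; apply/forallP => i; rewrite deviation_cover//.
rewrite /mass finset.big_trivIset//= mulr_sumr; apply: le_trans (ler_norm_sum _ _ _) _.
by apply: ler_sum => J /yB /forallP.
Qed.

(* The union bound runs over the points t instead of the segments of mf, so that
   the number of segments need not be estimated. *)
Lemma esp_not_well_estimated eps (V : R) mf :
  0 < eps < 1 -> (forall t i, 0 < mass s (finset.pblock mf t) i) ->
  (forall t i, V <= mass s (finset.pblock mf t) i) ->
  esp s (fun y => (~~ [forall t, well_estimated eps y (finset.pblock mf t)])%:R)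
  <= 2 * n%:R * r%:R * expR (- ((1 - eps) * eps ^+ 2 / 2 * V)).
Proof.
move=> e01 v_gt0 hV.
apply: le_trans (_ : esp s (fun y => \sum_t \sum_i
  (eps * mass s (finset.pblock mf t) i <=
    `|deviation s y (finset.pblock mf t) i|)%R%:R) <= _).
  apply: ler_esp => // y; case: (boolP [forall t, _]) => [_|].
    by apply: sumr_ge0 => t _; apply: sumr_ge0.
  rewrite negb_forall => /existsP[t]; rewrite negb_forall => /existsP[i].
  rewrite -ltNge => yti; rewrite (bigD1 t)//= (bigD1 i)//= (ltW yti).
  by rewrite -addrA lerDl addr_ge0// ?sumr_ge0// => t' _; apply: sumr_ge0.
rewrite esp_sum (_ : 2 * _ * _ * _ = \sum_(t < n) \sum_(i < r)
    2 * expR (- ((1 - eps) * eps ^+ 2 / 2 * V))); last first.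
  by rewrite !sumr_const !card_ord -mulrnA -[RHS]mulr_natr natrM; ring.
apply: ler_sum => t _; rewrite esp_sum; apply: ler_sum => i _.
have v0 := v_gt0 t i.
apply: le_trans (deviation_tail s_ge0 s_sum1 e01 v0 _) _.
  by rewrite lexx andbT mulr_ge0// ltW//; lra.
rewrite ler_pM2l// ler_expR lerN2.
set v := mass _ _ _ in v0 *.
have -> : (1 - eps) * (eps * v) ^+ 2 / (2 * v) = (1 - eps) * eps ^+ 2 / 2 * v.
  by field; rewrite gt_eqF.
by rewrite ler_wpM2l ?hV// divr_ge0// mulr_ge0 ?sqr_ge0//; lra.
Qed.

End SegmentDivergence.

(** * Contrast, Kullback-Leibler and Hellinger *)

Section ContrastHellinger.
Variables (R : realType) (n r : nat) (s : 'I_n -> 'I_r -> R).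
Local Notation sample := {ffun 'I_n -> 'I_r}.
Implicit Types (m : {set {set 'I_n}}) (u w : 'I_n -> 'I_r -> R).

Hypothesis s_gt0 : forall t i, 0 < s t i.
Hypothesis s_sum1 : forall t, \sum_i s t i = 1.

Let s_ge0 t i : 0 <= s t i. Proof. exact: ltW. Qed.

Lemma contrastE (y : 'I_n -> 'I_r) u : contrast y u = - \sum_t ln (u t (y t)).
Proof.
congr (- _); apply: eq_bigr => t _; rewrite (bigD1 (y t))//= eqxx mul1r.
by rewrite big1 ?addr0// => i; rewrite eq_sym => /negPf->; rewrite mul0r.
Qed.

Lemma projectionE m t i :
  projection s m t i = mass s (finset.pblock m t) i / #|finset.pblock m t|%:R.
Proof. by rewrite /projection mulrC. Qed.

Lemma mc_estimatorE (y : 'I_n -> 'I_r) m t i :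
  mc_estimator R y m t i =
  count_in R y (finset.pblock m t) i / #|finset.pblock m t|%:R.
Proof. by []. Qed.

Section Partition.
Variable m : {set {set 'I_n}}.
Hypothesis pm : finset.partition m [set: 'I_n]%SET.

Lemma pblock_in t : finset.pblock m t \in m.
Proof.
by apply: pblock_mem; rewrite (cover_partition pm) inE.
Qed.

Lemma in_pblock t : t \in finset.pblock m t.
Proof. by rewrite mem_pblock (cover_partition pm) inE. Qed.

Lemma block_neq0 J : J \in m -> J != finset.set0.
Proof.
by case/and3P: pm => _ _ s0 Jm; apply: contraNneq s0 => <-.
Qed.

Lemma card_pblock_gt0 t : 0 < #|finset.pblock m t|%:R :> R.
Proof. by rewrite ltr0n card_gt0 block_neq0// pblock_in. Qed.

Lemma sum_pblock (V : nmodType) (F : {set 'I_n} -> 'I_n -> V) :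
  \sum_t F (finset.pblock m t) t = \sum_(J in m) \sum_(t in J) F J t.
Proof.
have tm : finset.trivIset m by case/and3P: pm.
rewrite (eq_bigl [in [set: 'I_n]%SET]) => [|t]; last by rewrite inE.
rewrite (finset.set_partition_big _ pm)/=; apply: eq_bigr => J Jm.
by apply: eq_bigr => t tJ; rewrite (def_pblock tm Jm tJ).
Qed.

Lemma projection_gt0 t i : 0 < projection s m t i.
Proof.
rewrite projectionE divr_gt0 ?card_pblock_gt0//.
by rewrite mass_gt0 ?block_neq0 ?pblock_in.
Qed.

Lemma projection_sum1 t : \sum_i projection s m t i = 1.
Proof.
under eq_bigr do rewrite projectionE.
rewrite -mulr_suml /mass exchange_big /=.
rewrite (eq_bigr (fun=> 1)) => [|t' _]; last exact: s_sum1.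
by rewrite sumr_const divff// gt_eqF// card_pblock_gt0.
Qed.

Lemma contrast_projectionB (y : 'I_n -> 'I_r) :
  contrast y (projection s m) - contrast y (mc_estimator R y m) =
  \sum_(J in m) segment_KL s y J.
Proof.
rewrite !contrastE opprK addrC -sumrB.
rewrite (eq_bigr (fun t => ln (count_in R y (finset.pblock m t) (y t) /
    mass s (finset.pblock m t) (y t)))) => [|t _]; last first.
  (* The point [t] itself is counted, so no logarithm of 0 occurs. *)
  have N0 : 0 < count_in R y (finset.pblock m t) (y t).
    rewrite /count_in (bigD1 t) ?in_pblock//= eqxx ltr_pwDl//.
    exact: sumr_ge0.
  have v0 : 0 < mass s (finset.pblock m t) (y t).
    by rewrite mass_gt0// block_neq0// pblock_in.
  have c0 := card_pblock_gt0 t.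
  rewrite mc_estimatorE projectionE -ln_div ?posrE ?divr_gt0//.
  by congr ln; field; rewrite !gt_eqF.
rewrite (sum_pblock (fun J t => ln (count_in R y J (y t) / mass s J (y t)))).
apply: eq_bigr => J Jm; rewrite /segment_KL.
under [RHS]eq_bigr do rewrite mulr_suml.
rewrite exchange_big; apply: eq_bigr => t tJ /=.
rewrite (bigD1 (y t))//= eqxx mul1r big1 ?addr0// => i.
by rewrite eq_sym => /negPf->; rewrite mul0r.
Qed.

Lemma hellinger2_projection_le (y : 'I_n -> 'I_r) :
  2 * hellinger2 (projection s m) (mc_estimator R y m) <=
  \sum_(J in m) segment_KL s y J.
Proof.
rewrite /hellinger2 mulrA divff// mul1r.
pose F (J : {set 'I_n}) : R := \sum_i
  (Num.sqrt (count_in R y J i) - Num.sqrt (mass s J i)) ^+ 2 / #|J|%:R.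
rewrite (eq_bigr (fun t => F (finset.pblock m t))) => [|t _]; last first.
  apply: eq_bigr => i _; rewrite projectionE mc_estimatorE.
  rewrite !sqrtrM ?mass_ge0 ?count_in_ge0// -mulrBl exprMn.
  by rewrite sqr_sqrtr ?invr_ge0 ?ltW ?card_pblock_gt0// -sqrrN opprB.
rewrite (sum_pblock (fun J _ => F J)); apply: ler_sum => J Jm.
rewrite sumr_const /F -mulr_suml -[leLHS]mulr_natr mulfVK.
  exact/segment_KL_ge_sqrt/block_neq0.
by rewrite pnatr_eq0 cards_eq0 block_neq0.
Qed.

Lemma mc_estimator_sum1 (y : 'I_n -> 'I_r) t : \sum_i mc_estimator R y m t i = 1.
Proof.
under eq_bigr do rewrite mc_estimatorE.
rewrite -mulr_suml /count_in exchange_big /=.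
rewrite (eq_bigr (fun=> 1)) => [|t' _].
  by rewrite sumr_const divff// gt_eqF// card_pblock_gt0.
rewrite (bigD1 (y t'))//= eqxx big1 ?addr0// => i.
by rewrite eq_sym => /negPf->.
Qed.

End Partition.

Lemma hellinger2_ge0 u w : 0 <= hellinger2 u w.
Proof.
rewrite mulr_ge0 ?invr_ge0//; apply: sumr_ge0 => t _.
by apply: sumr_ge0 => i _; exact: sqr_ge0.
Qed.

Lemma hellinger2_triangle u v w :
  hellinger2 u w <= 2 * hellinger2 u v + 2 * hellinger2 v w.
Proof.
rewrite /hellinger2 !mulrA -!mulrDr divff// mulrC !mul1r ler_pdivrMr//.
rewrite mulrC -big_split/= mulr_sumr; apply: ler_sum => t _.
rewrite -big_split/= mulr_sumr; apply: ler_sum => i _.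
(* The difference of the two sides is exactly this square. *)
have := sqr_ge0 (Num.sqrt (u t i) + Num.sqrt (w t i) - 2 * Num.sqrt (v t i)).
by nra.
Qed.

(** Crude bound for the event where the counts are not controlled, from
    [(sqrt a - sqrt b) ^+ 2 <= a + b]. *)
Lemma hellinger2_le_card u w :
  (forall t i, 0 <= u t i) -> (forall t i, 0 <= w t i) ->
  (forall t, \sum_i u t i = 1) -> (forall t, \sum_i w t i = 1) ->
  hellinger2 u w <= n%:R.
Proof.
move=> u0 w0 u1 w1; rewrite /hellinger2 ler_pdivrMl//.
have -> : 2 * n%:R = \sum_(t < n) 2 :> R by rewrite sumr_const card_ord mulr_natr.
apply: ler_sum => t _.
have -> : 2 = \sum_i (u t i + w t i) :> R by rewrite big_split/= u1 w1.
apply: ler_sum => i _.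
rewrite -[in leRHS](sqr_sqrtr (u0 t i)) -[in leRHS](sqr_sqrtr (w0 t i)).
have := mulr_ge0 (sqrtr_ge0 (u t i)) (sqrtr_ge0 (w t i)); nra.
Qed.

(* The expectation is a product over t of affinities 1 - h_t^2 <= exp(- h_t^2). *)
Lemma esp_expR_contrastB w : (forall t i, 0 < w t i) ->
  (forall t, \sum_i w t i = 1) ->
  esp s (fun y => expR ((contrast y s - contrast y w) / 2)) <=
  expR (- hellinger2 s w).
Proof.
move=> w0 w1; pose F t i : R := Num.sqrt (w t i) / Num.sqrt (s t i).
rewrite (@eq_esp _ _ _ _ _ (fun y => \prod_t F t (y t))) => [|y]; last first.
  rewrite !contrastE opprK addrC -sumrB mulr_suml expR_sum.
  apply: eq_bigr => t _; set a := w _ _; set b := s _ _.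
  have a0 : 0 < Num.sqrt a by rewrite sqrtr_gt0 w0.
  have b0 : 0 < Num.sqrt b by rewrite sqrtr_gt0 s_gt0.
  have lnE x : 0 < Num.sqrt x -> ln x = 2 * ln (Num.sqrt x) :> R.
    by rewrite sqrtr_gt0 => x0; rewrite mulr_natl -lnXn ?sqrtr_gt0// sqr_sqrtr// ltW.
  rewrite (lnE a)// (lnE b)// -mulrBr mulrAC divff// mul1r.
  by rewrite -ln_div ?posrE// lnK ?posrE// divr_gt0.
rewrite esp_prod /hellinger2 mulr_sumr -sumrN expR_sum; apply: ler_prod => t _.
rewrite sumr_ge0/= => [|i _]; last by rewrite mulr_ge0// divr_ge0// sqrtr_ge0.
apply: le_trans (expR_ge1Dx _).
have -> : \sum_i s t i * F t i = \sum_i Num.sqrt (s t i) * Num.sqrt (w t i).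
  apply: eq_bigr => i _; rewrite /F -{1}(sqr_sqrtr (s_ge0 t i)).
  by field; rewrite gt_eqF// sqrtr_gt0.
have -> : \sum_i (Num.sqrt (s t i) - Num.sqrt (w t i)) ^+ 2 =
    \sum_i s t i + \sum_i w t i - 2 * \sum_i Num.sqrt (s t i) * Num.sqrt (w t i).
  rewrite mulr_sumr -big_split -sumrB; apply: eq_bigr => i _ /=.
  by have := sqr_sqrtr (s_ge0 t i); have := sqr_sqrtr (ltW (w0 t i)); nra.
by rewrite s_sum1 w1; lra.
Qed.

Lemma esp_contrastB w : (forall t i, 0 < w t i) ->
  esp s (fun y => contrast y w - contrast y s) = KL s w.
Proof.
move=> w0.
rewrite (@eq_esp _ _ _ _ _ (fun y => \sum_t ln (s t (y t) / w t (y t)))) => [|y].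
  rewrite esp_sum; apply: eq_bigr => t _.
  exact: (esp_coord s_sum1 t (fun i => ln (s t i / w t i))).
rewrite !contrastE opprK addrC -sumrB; apply: eq_bigr => t _.
by rewrite ln_div ?posrE.
Qed.

End ContrastHellinger.

(** * Risk bound on the finite sample space *)

Section RiskBound.
Variable R : realType.

(* The rate c is small when L is small, so that the variance term 4 c^2 fits in
   the gap between kappa and kappa^2, and of order sqrt L otherwise. *)
Lemma exists_rate (kappa q : R) : 1 < kappa -> 0 <= q ->
  exists2 c, Num.min ((kappa ^+ 2 - kappa) / 8) (1 / 7) <= c <= 1 / 7 &
    c * kappa / 2 + 4 * c ^+ 2 + q ^+ 2 <=
    c * (kappa ^+ 2 / 2) * (1 + 8 * q + 14 * q ^+ 2).
Proof.
move=> k1 q0; set c0 := Num.min _ _.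
have c07 : c0 <= 1 / 7 by rewrite ge_min lexx orbT.
have c0k : c0 <= (kappa ^+ 2 - kappa) / 8 by rewrite ge_min lexx.
have c00 : 0 < c0 by rewrite lt_min; apply/andP; split; nra.
have kk : kappa <= kappa ^+ 2 by nra.
have kk1 : 1 <= kappa ^+ 2 by nra.
have split_rhs c : 0 <= c -> c * kappa / 2 + 4 * c ^+ 2 + q ^+ 2 <=
    c * kappa ^+ 2 / 2 + c * (4 * q + 7 * q ^+ 2) ->
    c * kappa / 2 + 4 * c ^+ 2 + q ^+ 2 <=
    c * (kappa ^+ 2 / 2) * (1 + 8 * q + 14 * q ^+ 2).
  move=> c_0 h; apply: le_trans h _.
  have -> : c * (kappa ^+ 2 / 2) * (1 + 8 * q + 14 * q ^+ 2) =
    c * kappa ^+ 2 / 2 + kappa ^+ 2 * (c * (4 * q + 7 * q ^+ 2)) by field.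
  rewrite lerD2l ler_peMl// mulr_ge0//; nra.
(* The regimes take [c = c0], [c = q / 2] and [c = 1 / 7]. In the first, [q ^+ 2 <= 2 * c0 * q] and
   [4 * c0 ^+ 2] fits in the gap; in the second, [4 * c ^+ 2 + q ^+ 2 = 4 * c * q]; in the third,
   [7 * c * q ^+ 2 = q ^+ 2]. *)
have [qs|ql] := leP q (2 * c0).
  exists c0; first by rewrite lexx.
  apply: split_rhs; first exact: ltW.
  have h1 : q ^+ 2 <= 2 * c0 * q by rewrite expr2 ler_wpM2r.
  have h2 : 4 * c0 ^+ 2 <= c0 * ((kappa ^+ 2 - kappa) / 2).
    have -> : 4 * c0 ^+ 2 = c0 * (4 * c0) by ring.
    by rewrite ler_pM2l//; lra.
  have h3 : 0 <= c0 * q ^+ 2 by rewrite mulr_ge0 ?sqr_ge0// ltW.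
  have h4 : 0 <= c0 * q by rewrite mulr_ge0// ltW.
  by lra.
have [qm|qb] := leP q (2 / 7).
  exists (q / 2); first by lra.
  apply: split_rhs; first lra.
  have h3 : 0 <= q * q ^+ 2 by rewrite mulr_ge0 ?sqr_ge0// ltW.
  have h4 : q * kappa <= q * kappa ^+ 2 by rewrite ler_wpM2l.
  by lra.
exists (1 / 7); first by rewrite c07 lexx.
by apply: split_rhs; [lra | nra].
Qed.

(** For [x = ln n], completing the square gives [2 * x - cc * x ^+ 2 <= 1 / cc]. One factor [n]
    comes from the union bound, the other from the bounds linear in [n] used off the good event. *)
Lemma sqr_expR_le (cc : R) (n : nat) : 0 < cc -> (0 < n)%N ->
  n%:R ^+ 2 * expR (- (cc * ln n%:R ^+ 2)) <= expR (cc^-1).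
Proof.
move=> cc0 n0; set x := ln _.
have -> : n%:R = expR x :> R by rewrite lnK// posrE ltr0n.
rewrite -expRM_natl -expRD ler_expR.
rewrite -(ler_pM2l cc0) divff ?gt_eqF//.
have := sqr_ge0 (cc * x - 1); nra.
Qed.

Variables (n r : nat) (s : 'I_n -> 'I_r -> R).
Variables (kappa eps rho Gamma : R).
Variables (M : {set {set {set 'I_n}}}) (mf : {set {set 'I_n}}).
Variables L pen : {set {set 'I_n}} -> R.
Local Notation sample := {ffun 'I_n -> 'I_r}.

Hypothesis n_gt0 : (0 < n)%N.
Hypothesis r_ge2 : (2 <= r)%N.
Hypothesis kappa_gt1 : 1 < kappa.
Hypothesis eps_small : 0 < eps <= 1 / 20.
Hypothesis eps_kappa : (1 - eps)^-1 <= kappa.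
Hypothesis rho_gt0 : 0 < rho.
Hypothesis Gamma_gt0 : 0 < Gamma.
Hypothesis s_ge_rho : forall t i, rho <= s t i.
Hypothesis s_sum1 : forall t, \sum_i s t i = 1.
Hypothesis M_partition : forall m, m \in M -> finset.partition m [set: 'I_n]%SET.
Hypothesis L_ge0 : forall m, m \in M -> 0 <= L m.
Hypothesis mf_partition : finset.partition mf [set: 'I_n]%SET.
Hypothesis M_mf : forall m, m \in M -> constructed_on mf m.
Hypothesis mf_card : forall J, J \in mf -> Gamma * ln n%:R ^+ 2 <= #|J|%:R.
Hypothesis pen_ge0 : forall m, m \in M -> 0 <= pen m.
Hypothesis pen_ge : forall m, m \in M ->
  kappa ^+ 3 / 2 * r%:R * #|m|%:R * (1 + 4 * Num.sqrt (L m)) ^+ 2 <= pen m.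

Let s_gt0 t i : 0 < s t i. Proof. exact: lt_le_trans (s_ge_rho t i). Qed.
Let s_ge0 t i : 0 <= s t i. Proof. exact: ltW. Qed.
Let e01 : 0 < eps < 1.
Proof. by move: eps_small => /andP[-> e20]; apply: le_lt_trans e20 _; lra. Qed.
Let r_gt0 : (0 < r)%N. Proof. exact: leq_trans r_ge2. Qed.
Let rR : 0 < r%:R :> R. Proof. by rewrite ltr0n. Qed.

Let A := 2 * kappa / (kappa - 1).
Let c0 := Num.min ((kappa ^+ 2 - kappa) / 8) (1 / 7 : R).
Let proj m := projection s m.
Let KLs (m : {set {set 'I_n}}) (y : sample) := \sum_(J in m) segment_KL s y J.
Let good (y : sample) :=
  [forall t, well_estimated s eps y (finset.pblock mf t)].

Let A_ge2 : 2 <= A.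
Proof. by rewrite /A ler_pdivlMr ?subr_gt0//; lra. Qed.

(** Of the three factors [kappa] in the penalty bound, one pays for [1 + 1 / A], one for
    [(1 - eps)^-1], and the last leaves the gap between [kappa] and [kappa ^+ 2] used by
    [exists_rate]. *)
Let A_kappa : 1 + 1 / A <= kappa.
Proof.
have k1 := kappa_gt1; have k0 : 0 < kappa by lra.
have -> : 1 + 1 / A = 1 + (kappa - 1) / (2 * kappa).
  by rewrite /A; field; rewrite !gt_eqF//; lra.
rewrite -lerBrDl ler_pdivrMr; nra.
Qed.

Let c0_gt0 : 0 < c0.
Proof. by have k1 := kappa_gt1; rewrite lt_min; apply/andP; split; nra. Qed.

Let good_all m y : m \in M -> good y ->
  [forall J in m, well_estimated s eps y J].
Proof.
move=> mM /forallP gy; apply/forall_inP => J Jm.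
have [B Bmf ->] := M_mf mM Jm.
have [tmf smf] : finset.trivIset mf /\ finset.set0 \notin mf.
  by case/and3P: mf_partition.
apply: well_estimated_cover; first exact: trivIsetS tmf.
move=> K KB; have Kmf := fintype.subsetP Bmf _ KB.
have /set0Pn[t tK] : K != finset.set0 by apply: contraNneq smf => <-.
by rewrite -(def_pblock tmf Kmf tK).
Qed.

Let cc := (1 - eps) * eps ^+ 2 / 2 * (rho * Gamma).
Let B := 2 * r%:R * expR (cc^-1).

Let esp_not_good : n%:R * esp s (fun y => (~~ good y)%:R) <= B.
Proof.
have e1 := e01; have cc0 : 0 < cc.
  rewrite mulr_gt0 ?mulr_gt0 ?exprn_gt0 ?invr_gt0//; lra.
have hV t i : rho * (Gamma * ln n%:R ^+ 2) <= mass s (finset.pblock mf t) i.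
  apply: le_trans (_ : rho * #|finset.pblock mf t|%:R <= _).
    by rewrite ler_pM2l ?mf_card ?pblock_in.
  rewrite mulr_natr -sumr_const; apply: ler_sum => t' _; exact: s_ge_rho.
have v0 t i : 0 < mass s (finset.pblock mf t) i.
  by rewrite mass_gt0// (block_neq0 mf_partition)// pblock_in.
have := esp_not_well_estimated s_gt0 s_sum1 e01 v0 hV.
rewrite -/good => h; apply: le_trans (_ : n%:R * (2 * n%:R * r%:R *
  expR (- ((1 - eps) * eps ^+ 2 / 2 * (rho * (Gamma * ln n%:R ^+ 2))))) <= _).
  by rewrite ler_wpM2l.
have -> : (1 - eps) * eps ^+ 2 / 2 * (rho * (Gamma * ln n%:R ^+ 2)) =
  cc * ln n%:R ^+ 2 by rewrite /cc; ring.
have -> a : n%:R * (2 * n%:R * r%:R * a) = 2 * r%:R * (n%:R ^+ 2 * a) :> R by ring.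
by rewrite ler_wpM2l ?mulr_ge0// sqr_expR_le.
Qed.

(** The bracket to be controlled is [U m y + V m y]. The amount [2 * (L m * #|m|%:R)] is moved from
    the penalty to [U], so that the moment of [U] is summable over [M]. *)
Let U m (y : sample) := 2 / A * hellinger2 s (proj m) +
  (contrast y s - contrast y (proj m)) - 2 * (L m * #|m|%:R).
Let V m (y : sample) := (1 + 1 / A) * KLs m y - pen m + 2 * (L m * #|m|%:R).

(** The affinity bound [expR (- h)] absorbs [expR (h / A)], since [A >= 1]. *)
Let esp_U m : m \in M -> esp s (fun y => expR (U m y / 2)) <= expR (- (L m * #|m|%:R)).
Proof.
move=> mM; have pm := M_partition mM; have A2 := A_ge2.
pose h := hellinger2 s (proj m).
rewrite (@eq_esp _ _ _ _ _ (fun y => expR (h / A - L m * #|m|%:R) *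
    expR ((contrast y s - contrast y (proj m)) / 2))) => [|y]; last first.
  by rewrite -expRD /U; congr expR; rewrite /h; field; rewrite gt_eqF//; lra.
rewrite espZ; apply: le_trans (_ : expR (h / A - L m * #|m|%:R) * expR (- h) <= _).
  rewrite ler_pM2l ?expR_gt0//; apply: esp_expR_contrastB => // t.
    exact: projection_gt0.
  exact: projection_sum1.
rewrite -expRD ler_expR; suff : h / A <= h by lra.
by rewrite ler_pdivrMr ?ler_peMr ?hellinger2_ge0//; lra.
Qed.

Let excess m (y : sample) := (good y)%:R * Num.max 0 (U m y + V m y).

(** Positive parts are bounded by exponentials through [z <= expR (b * z) / b], with [b = 1 / 2] for
    [U] and [b = c / r] for [V]. Since [c >= c0], the prefactor is uniform in [m]. *)
Let esp_excess m : m \in M ->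
  esp s (excess m) <= (2 + kappa * r%:R / c0) * expR (- (L m * #|m|%:R)).
Proof.
move=> mM; have pm := M_partition mM.
have tm : finset.trivIset m by case/and3P: pm.
have m0 J : J \in m -> J != finset.set0 by exact: (block_neq0 pm).
have KL0 y : 0 <= KLs m y by apply: sumr_ge0 => J /m0 J0; exact: segment_KL_ge0.
have [c /andP[c0c c7] hc] := exists_rate kappa_gt1 (sqrtr_ge0 (L m)).
rewrite -/c0 in c0c; have cgt0 : 0 < c by exact: lt_le_trans c0c.
have k1 := kappa_gt1; have kgt0 : 0 < kappa by lra.
set x := #|m|%:R in hc *; have x0 : 0 <= x by rewrite ler0n.
pose p := (pen m - 2 * (L m * x)) / kappa.
pose good' y := [forall J in m, well_estimated s eps y J].
pose th := c / r%:R; have th0 : 0 < th by rewrite divr_gt0.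
pose W (y : sample) := 2 * expR (U m y / 2) + kappa / th * expR (- (th * p)) *
  ((good' y)%:R * expR (th * KLs m y)).
have W0 y : 0 <= W y.
  by apply: addr_ge0; rewrite !mulr_ge0 ?invr_ge0 ?expR_ge0// ltW.
apply: le_trans (_ : esp s W <= _).
  apply: ler_esp => // y; rewrite /excess.
  case: (boolP (good y)) => gy; last by rewrite mul0r.
  rewrite mul1r ge_max W0 lerD//.
    by have := expR_ge1Dx (U m y / 2); lra.
  rewrite /good' (good_all mM gy) mul1r.
  apply: le_trans (_ : kappa * (KLs m y - p) <= _).
    have -> : kappa * (KLs m y - p) = kappa * KLs m y - pen m + 2 * (L m * x).
      by rewrite /p; field; rewrite gt_eqF.
    by rewrite /V !lerD2r ler_wpM2r.
  rewrite -mulrA -expRD -mulrA ler_pM2l// ler_pdivlMl//.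
  have := expR_ge1Dx (th * (KLs m y - p)).
  have -> : - (th * p) + th * KLs m y = th * (KLs m y - p) by ring.
  lra.
rewrite /W espD !espZ [leRHS]mulrDl lerD ?ler_pM2l ?esp_U//.
apply: le_trans (_ : kappa / th * expR (- (th * p)) *
    expR (x * (c / (2 * (1 - eps)) + 4 * c ^+ 2)) <= _).
  rewrite ler_pM2l ?mulr_gt0 ?expR_gt0 ?invr_gt0//.
  by apply: esp_expR_partition_KL => //; rewrite c7 ltW.
rewrite -mulrA -expRD ler_pM ?expR_ge0//.
- by rewrite divr_ge0// ltW.
- rewrite /th invf_div mulrA ler_wpM2l ?lef_pV2 ?posrE//.
  by rewrite mulr_ge0// ltW.
rewrite ler_expR.
have ceps : c / (2 * (1 - eps)) <= c * kappa / 2.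
  by rewrite invfM mulrA mulrAC ler_wpM2r// ler_wpM2l// ltW.
have hL : Num.sqrt (L m) ^+ 2 = L m by rewrite sqr_sqrtr// L_ge0.
set q := Num.sqrt (L m) in hc hL; have q0 : 0 <= q by exact: sqrtr_ge0.
have k3r : 1 <= kappa ^+ 3 / 2 * r%:R.
  have r2 : 2 <= r%:R :> R by rewrite ler_nat.
  have k3 : 1 <= kappa ^+ 3 by rewrite exprn_ege1// ltW.
  by nra.
(* Of the [16 * q ^+ 2] in [(1 + 4 * q) ^+ 2], two units pay for the [2 * (L m * x)] subtracted in
   [p], by [k3r]; 14 remain. *)
have pp : x * (r%:R * (kappa ^+ 2 / 2 * (1 + 8 * q + 14 * q ^+ 2))) <= p.
  rewrite /p ler_pdivlMr//.
  have := pen_ge mM; rewrite -/q -/x -hL.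
  have : x * q ^+ 2 <= kappa ^+ 3 / 2 * r%:R * (x * q ^+ 2).
    by rewrite ler_peMl// mulr_ge0// sqr_ge0.
  lra.
have : th * (x * (r%:R * (kappa ^+ 2 / 2 * (1 + 8 * q + 14 * q ^+ 2)))) <= th * p.
  by rewrite ler_pM2l.
have -> : th * (x * (r%:R * (kappa ^+ 2 / 2 * (1 + 8 * q + 14 * q ^+ 2)))) =
    x * (c * (kappa ^+ 2 / 2) * (1 + 8 * q + 14 * q ^+ 2)).
  by rewrite /th; field; rewrite gt_eqF.
have : x * (c * kappa / 2 + 4 * c ^+ 2 + q ^+ 2) <=
  x * (c * (kappa ^+ 2 / 2) * (1 + 8 * q + 14 * q ^+ 2)) by rewrite ler_wpM2l.
have : x * (c / (2 * (1 - eps))) <= x * (c * kappa / 2) by rewrite ler_wpM2l.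
rewrite -hL; lra.
Qed.

(** The terms in [B] come from the bad event, through the Hellinger distance and through the
    contrast gap; the last one sums [esp_excess] over [M]. *)
Definition risk_constant (Sigma : R) : R :=
  B * (1 + A * `|ln rho|) + A * (2 + kappa * r%:R / c0) * Sigma.

(** The majorant [G] depends on the sample alone: summing [excess] over [M] removes the selected
    partition, which need not be a function of the sample when there are ties. *)
Lemma finite_risk_bound (m0 : {set {set 'I_n}}) : m0 \in M ->
  exists2 G : sample -> R,
    esp s G <= A * (KL s (proj m0) + pen m0) +
      risk_constant (\sum_(m in M) expR (- (L m * #|m|%:R))) &
    forall (y : sample) m, m \in M ->
      penalized_criterion y pen m <= penalized_criterion y pen m0 ->
      hellinger2 s (mc_estimator R y m) <= G y.
Proof.
move=> m0M; have pm0 := M_partition m0M.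
pose gap (y : sample) := contrast y (proj m0) - contrast y s.
pose G (y : sample) := n%:R * (~~ good y)%:R +
  A * ((good y)%:R * gap y + pen m0 + \sum_(m in M) excess m y).
have A2 := A_ge2; have A0 : 0 < A by lra.
exists G.
  (* Restricting [gap] to the good event can increase its mean, but [- gap y <= n * |ln rho|]
     because [s >= rho] and the projection is at most 1. *)
  have gapE : esp s (fun y => (good y)%:R * gap y) <=
      KL s (proj m0) + n%:R * `|ln rho| * esp s (fun y => (~~ good y)%:R).
    rewrite -(esp_contrastB s_gt0 s_sum1 (projection_gt0 s_gt0 pm0)) -espZ -espD.
    apply: ler_esp => // y; rewrite -/(proj m0) -/(gap y).
    case: (good y); rewrite /= ?mul1r ?mulr0 ?addr0// mul0r mulr1.
    suff : - gap y <= n%:R * `|ln rho| by lra.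
    rewrite /gap opprB !contrastE opprK addrC -sumrB.
    apply: le_trans (_ : \sum_(t < n) `|ln rho| <= _); last first.
      by rewrite sumr_const card_ord mulr_natl.
    apply: ler_sum => t _.
    have pr0 := projection_gt0 s_gt0 pm0 t.
    have pr1 : proj m0 t (y t) <= 1.
      rewrite -(projection_sum1 s_sum1 pm0 t) (bigD1 (y t))//= lerDl.
      by apply: sumr_ge0 => i _; exact/ltW/pr0.
    have := ln_le0 pr1; have : ln rho <= ln (s t (y t)) by rewrite ler_ln ?posrE.
    have := ler_norm (- ln rho); rewrite normrN; lra.
  rewrite /G espD !espZ !espD esp_cst// esp_sum.
  have h1 : \sum_(m in M) esp s (excess m) <=
      (2 + kappa * r%:R / c0) * \sum_(m in M) expR (- (L m * #|m|%:R)).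
    by rewrite mulr_sumr; apply: ler_sum => m; exact: esp_excess.
  rewrite /risk_constant; set S := \sum_(m in M) expR _ in h1 *.
  have h2 : A * (esp s (fun y => (good y)%:R * gap y) + pen m0 +
      \sum_(m in M) esp s (excess m)) <=
    A * (KL s (proj m0) + n%:R * `|ln rho| * esp s (fun y => (~~ good y)%:R)
      + pen m0 + (2 + kappa * r%:R / c0) * S).
    by rewrite ler_pM2l// !lerD.
  have h3 := esp_not_good.
  have h4 : A * `|ln rho| * (n%:R * esp s (fun y => (~~ good y)%:R)) <=
    A * `|ln rho| * B by rewrite ler_wpM2l// mulr_ge0// ltW.
  lra.
move=> y m mM crit; have pm := M_partition mM.
have ex0 m' : 0 <= excess m' y by rewrite mulr_ge0// le_max lexx.
rewrite /G; case: (boolP (good y)) => gy; last first.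
  rewrite /= mulr1 mul0r add0r; apply: le_trans (_ : n%:R <= _).
    apply: hellinger2_le_card => //; last exact: mc_estimator_sum1.
    by move=> t i; rewrite mc_estimatorE divr_ge0// count_in_ge0.
  by rewrite lerDl mulr_ge0 ?addr_ge0 ?pen_ge0 ?sumr_ge0 ?(ltW A0).
rewrite /= mulr0 add0r mul1r.
have exm : excess m y <= \sum_(m in M) excess m y.
  by rewrite (bigD1 m)//= lerDl sumr_ge0.
have UV : U m y + V m y <= excess m y.
  by rewrite /excess gy mul1r le_max lexx orbT.
apply: le_trans (hellinger2_triangle s (proj m) (mc_estimator R y m)) _.
have h1 : 2 * hellinger2 (proj m) (mc_estimator R y m) <= KLs m y.
  exact: (hellinger2_projection_le s_gt0 s_sum1 pm).
have h2 : contrast y (mc_estimator R y m) + pen m <= contrast y (proj m0) + pen m0.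
  apply: le_trans crit _; rewrite /penalized_criterion lerD2r -subr_ge0.
  rewrite (contrast_projectionB s_gt0 pm0); apply: sumr_ge0 => J Jm.
  by apply: segment_KL_ge0 => //; exact: (block_neq0 pm0).
have h3 : contrast y (proj m) - contrast y (mc_estimator R y m) = KLs m y.
  exact: (contrast_projectionB s_gt0 pm).
(* Adds [A] times the nonnegative slack of [h2]. *)
apply: le_trans (_ : 2 * hellinger2 s (proj m) + KLs m y + A *
   (contrast y (proj m0) + pen m0 - contrast y (mc_estimator R y m) - pen m) <= _).
  by rewrite -[leLHS]addr0 lerD ?lerD2l// mulr_ge0 ?(ltW A0)//; lra.
have -> : 2 * hellinger2 s (proj m) + KLs m y + A *
   (contrast y (proj m0) + pen m0 - contrast y (mc_estimator R y m) - pen m) =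
   A * (gap y + pen m0 + (U m y + V m y)).
  rewrite /U /V /gap -h3; field.
  by rewrite gt_eqF.
by rewrite ler_pM2l// lerD2l (le_trans UV).
Qed.

End RiskBound.

(** * Reduction to the finite sample space *)

Section DiscreteExpectation.
Local Open Scope classical_set_scope.
Context (d : measure_display) (T : measurableType d) (R : realType).
Variable P : probability T R.

Lemma expectation_discrete (F : finType) (Z : T -> F) (f : F -> R) :
  discrete_rv Z -> (forall z, 0 <= f z) ->
  ('E_P[fun w => f (Z w)] = (\sum_z f z * fine (P (Z @^-1` [set z])))%:E)%E.
Proof.
move=> mZ f0; rewrite unlock.
have -> : (fun w => (f (Z w))%:E) =
    (fun w => \sum_(z <- enum F) (f z * \1_(Z @^-1` [set z]) w)%:E)%E.
  apply/funext => w; rewrite sumEFin; congr EFin.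
  rewrite big_enum/= (bigD1 (Z w))//= indicE mem_set// mulr1 big1 ?addr0//.
  move=> z zw; rewrite indicE memNset ?mulr0// => /= e.
  by rewrite e eqxx in zw.
have m1 z : measurable_fun [set: T] (\1_(Z @^-1` [set z]) : T -> R).
  exact: measurable_realfun.measurable_indic.
rewrite ge0_integral_sum//=; last 2 first.
  move=> z; apply/measurable_realfun.measurable_EFinP.
  exact/measurable_realfun.measurable_funM.
  by move=> z w _; rewrite lee_fin mulr_ge0.
rewrite -sumEFin big_enum/=; apply: eq_bigr => z _.
under eq_integral do rewrite EFinM.
rewrite ge0_integralZl_EFin//; last by apply/measurable_realfun.measurable_EFinP.
by rewrite integral_indic// setIT EFinM fineK// fin_num_measure.
Qed.

(** The expectation of one indicator is computed in two ways, through [Z] and through [g \o Z]. *)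
Lemma sum_discrete_law (F K : finType) (Z : T -> F) (g : F -> K) (k : K) :
  discrete_rv Z -> discrete_rv (g \o Z) ->
  \sum_(z | g z == k) fine (P (Z @^-1` [set z])) =
  fine (P ((g \o Z) @^-1` [set k])).
Proof.
move=> mZ mgZ.
have h1 := @expectation_discrete _ Z (fun z => (g z == k)%:R) mZ (fun z => ler0n _ _).
have h2 := @expectation_discrete _ (g \o Z) (fun z => (z == k)%:R) mgZ
  (fun z => ler0n _ _).
have [h] := etrans (esym h1) h2.
rewrite big_mkcond (eq_bigr (fun z =>
    (g z == k)%:R * fine (P (Z @^-1` [set z])))) => [|z _]; last first.
  by case: eqP; rewrite ?mul1r ?mul0r.
rewrite h (bigD1 k)//= eqxx mul1r big1 ?addr0//.
by move=> z /negPf->; rewrite mul0r.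
Qed.

Variables (n r : nat) (Y : 'I_n -> T -> 'I_r).
Hypothesis mY : forall t, discrete_rv (Y t).

Lemma law_sum1 t : \sum_i law P Y t i = 1.
Proof.
have := @expectation_discrete _ (Y t) (fun=> 1) (mY t) (fun=> ler01).
rewrite (expectation_cst P 1) => -[->].
by apply: eq_bigr => i _; rewrite mul1r.
Qed.

Let sampleY (w : T) : {ffun 'I_n -> 'I_r} := [ffun t => Y t w].

Lemma sample_preimage (y : {ffun 'I_n -> 'I_r}) :
  sampleY @^-1` [set y] =
  \bigcap_(t in [set` [set: 'I_n]%SET]) (Y t @^-1` [set y t]).
Proof.
apply/seteqP; split => w /=; first by move=> <- t _ /=; rewrite ffunE.
by move=> h; apply/ffunP => t; rewrite ffunE; apply: h; rewrite /= inE.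
Qed.

Lemma sample_discrete : discrete_rv sampleY.
Proof.
move=> y; rewrite sample_preimage.
by apply: fin_bigcap_measurable => // t _; exact: mY.
Qed.

Lemma sample_law (y : {ffun 'I_n -> 'I_r}) : mutually_independent P Y ->
  fine (P (sampleY @^-1` [set y])) = sample_weight (law P Y) y.
Proof.
move=> indY; rewrite sample_preimage (indY _ (fun t => [set y t])).
have -> : (\prod_(t in [set: 'I_n]%SET) P (Y t @^-1` [set y t]))%E =
    (\prod_t law P Y t (y t))%:E.
  rewrite -prodEFin; apply: eq_big => t; first by rewrite inE.
  by rewrite fineK// fin_num_measure//; exact: mY.
by [].
Qed.

(** The pair of the sample and [mh] is a discrete variable; once the integrand is bounded by [G],
    the second component is summed out. *)
Lemma expectation_le_esp (K : finType) (mh : T -> K)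
    (f : {ffun 'I_n -> 'I_r} -> K -> R) (G : {ffun 'I_n -> 'I_r} -> R) :
  mutually_independent P Y -> discrete_rv mh -> (forall y k, 0 <= f y k) ->
  (forall w, f (sampleY w) (mh w) <= G (sampleY w)) ->
  ('E_P[fun w => f (sampleY w) (mh w)] <= (esp (law P Y) G)%:E)%E.
Proof.
move=> indY mmh f0 fG.
pose Z w := (sampleY w, mh w).
have mZ : discrete_rv Z.
  move=> [y k]; have -> : Z @^-1` [set (y, k)] =
      sampleY @^-1` [set y] `&` mh @^-1` [set k].
    by apply/seteqP; split => w /= => [[<- <-]|[<- <-]].
  by apply: measurableI; [exact: sample_discrete|exact: mmh].
rewrite (@expectation_discrete _ Z (fun z => f z.1 z.2) mZ)// lee_fin.
apply: le_trans (_ : \sum_z G z.1 * fine (P (Z @^-1` [set z])) <= _).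
  apply: ler_sum => -[y k] _ /=.
  (* The hypothesis on [f] and [G] holds along outcomes only; pairs that are never attained have
     probability 0. *)
  have [->|/set0P[w /= [<- <-]]] := eqVneq (Z @^-1` [set (y, k)]) set0.
    by rewrite measure0 !mulr0.
  by rewrite ler_wpM2r// fine_ge0.
rewrite (partition_big (fun z => z.1) xpredT)//= le_eqVlt; apply/orP; left.
apply/eqP/eq_bigr => y _; rewrite -(sample_law _ indY).
rewrite -(@sum_discrete_law _ _ Z fst y mZ sample_discrete) mulrC big_distrr/=.
by apply: eq_bigr => z /eqP ->; rewrite mulrC.
Qed.

End DiscreteExpectation.

(** * Oracle inequality on a general probability space *)

Theorem theorem6p1 (R : realType) (Sigma : R) (r : nat) (lambda rho Gamma : R)
    (hr : (2 <= r)%N) (hlambda : 2^-1 < lambda)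
    (hrho : 0 < rho) (hGamma : 0 < Gamma) :
  exists2 C : R, 0 < C &
    forall (n : nat) (d : measure_display) (T : measurableType d)
      (P : probability T R) (Y : 'I_n -> T -> 'I_r)
      (M : {set {set {set 'I_n}}}) (mf : {set {set 'I_n}})
      (L pen : {set {set 'I_n}} -> R)
      (mhat : T -> {set {set 'I_n}}),
    (0 < n)%N ->
    (forall t, discrete_rv (Y t)) ->
    mutually_independent P Y ->
    (forall m, m \in M -> segment_partition m) ->
    (forall m, m \in M -> 0 < L m) ->
    \sum_(m in M) expR (- (L m * #|m|%:R)) = Sigma ->
    (forall t i, rho <= law P Y t i) ->
    segment_partition mf ->
    (forall m, m \in M -> constructed_on mf m) ->
    (forall J, J \in mf -> Gamma * (ln n%:R) ^+ 2 <= #|J|%:R) ->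
    (forall m, m \in M -> 0 <= pen m) ->
    (forall m, m \in M ->
       lambda * r%:R * #|m|%:R * (1 + 4 * Num.sqrt (L m)) ^+ 2 <= pen m) ->
    discrete_rv mhat ->
    (forall w, is_argmin M (penalized_criterion (Y ^~ w) pen) (mhat w)) ->
    ('E_P[fun w => hellinger2 (law P Y) (mc_estimator R (Y ^~ w) (mhat w))]
     <= (2 * ((2 * lambda) `^ (3^-1)) / ((2 * lambda) `^ (3^-1) - 1)
           * inf [set KL (law P Y) (projection (law P Y) m) + pen m
                 | m in [set` M]]%classic
         + C)%:E)%E.
Proof.
pose kappa : R := (2 * lambda) `^ 3^-1.
have l2 : 1 < 2 * lambda by rewrite -ltr_pdivrMl// mulr1.
have k3 : kappa ^+ 3 = 2 * lambda.
  rewrite -powR_mulrn ?powR_ge0// /kappa -powRrM mulVf// powRr1//.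
  by rewrite ltW// (lt_trans _ l2).
have k1 : 1 < kappa.
  rewrite ltNge; apply/negP => k1; move: l2; rewrite -k3 ltNge exprn_ile1//.
  exact: powR_ge0.
have k0 : 0 < kappa by lra.
(* The bound [1 / 20] serves the tail estimate, and [1 - kappa^-1] ensures
   [(1 - eps)^-1 <= kappa]. *)
pose eps : R := Num.min (1 / 20) (1 - kappa^-1).
have epsk : eps <= 1 - kappa^-1 by rewrite ge_min lexx orbT.
have eps20 : 0 < eps <= 1 / 20.
  rewrite lt_min ge_min lexx subr_gt0 invf_lt1// k1 !andbT; lra.
have e1 : 0 < 1 - eps by lra.
have epskappa : (1 - eps)^-1 <= kappa.
  by rewrite -[leRHS]invrK lef_pV2 ?posrE ?invr_gt0//; lra.
pose A : R := 2 * kappa / (kappa - 1).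
have A0 : 0 < A by rewrite divr_gt0 ?subr_gt0//; lra.
pose C0 S : R := risk_constant r kappa eps rho Gamma S.
have rR : 0 < r%:R :> R by rewrite ltr0n (leq_trans _ hr).
have C0_gt0 S : 0 <= S -> 0 < C0 S.
  move=> S0; rewrite /C0 /risk_constant ltr_pwDl//.
    rewrite mulr_gt0 ?mulr_gt0 ?expR_gt0//.
    by rewrite ltr_pwDl// mulr_ge0 ?normr_ge0 ?(ltW A0).
  have c0 : 0 < Num.min ((kappa ^+ 2 - kappa) / 8) (1 / 7) :> R.
    by rewrite lt_min; apply/andP; split; nra.
  apply: mulr_ge0 => //; apply: mulr_ge0; first exact: ltW.
  by rewrite addr_ge0// divr_ge0// ?mulr_ge0// ltW.
(* The absolute value makes the constant positive before [Sigma] is known to be a sum of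
   exponentials. *)
exists (C0 `|Sigma|); first exact/C0_gt0/normr_ge0.
move=> n d T P Y M mf L pen mhat n0 mY indY segM L0 SigmaE s_rho segmf M_mf
  mf_card pen0 pen_ge mmhat argmin.
set s := law P Y in s_rho *.
have s1 : forall t, \sum_i s t i = 1 by exact: law_sum1.
have Sigma0 : 0 <= Sigma by rewrite -SigmaE sumr_ge0// => m _; exact: expR_ge0.
rewrite ger0_norm// -/kappa -/A.
have bound m0 : m0 \in M ->
    ('E_P[fun w => hellinger2 s (mc_estimator R (Y ^~ w) (mhat w))] <=
     (A * (KL s (projection s m0) + pen m0) + C0 Sigma)%:E)%E.
  move=> m0M.
  have pen_ge' m : m \in M -> kappa ^+ 3 / 2 * r%:R * #|m|%:R *
      (1 + 4 * Num.sqrt (L m)) ^+ 2 <= pen m.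
    by move=> mM; rewrite k3 (_ : 2 * lambda / 2 = lambda); [exact: pen_ge|field].
  have [G EG hG] := finite_risk_bound n0 hr k1 eps20 epskappa hrho hGamma s_rho
    s1 (fun m mM => (segM m mM).1) (fun m mM => ltW (L0 m mM)) segmf.1 M_mf
    mf_card pen0 pen_ge' m0M.
  rewrite SigmaE in EG.
  apply: le_trans (_ : (esp s G)%:E <= _)%E; last by rewrite lee_fin.
  have YE w : Y ^~ w = [ffun t => Y t w] :> ('I_n -> 'I_r).
    by apply/funext => t; rewrite ffunE.
  under [in leLHS]eq_fun do rewrite YE.
  apply: (expectation_le_esp mY
    (f := fun y m => hellinger2 s (mc_estimator R y m)) indY mmhat) => [y m|w].
    exact: hellinger2_ge0.
  have [mhM minw] := argmin w; apply: hG => //.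
  by rewrite -YE; exact: minw.
(* A probability space is nonempty, hence so is [M], which contains [mhat w0]. *)
have [w0 _] : ([set: T] !=set0)%classic.
  apply/set0P/eqP => T0; have := @probability_setT _ _ _ P.
  by rewrite T0 measure0 => -[] /eqP; rewrite eq_sym oner_eq0.
have [mhM _] := argmin w0.
(* The finite case passes to the infimum; the value [+oo] is excluded by the bound at [mhat w0]. *)
case: ('E_P[_])%E bound => [x| |] bound; last exact: leNye.
  rewrite lee_fin -lerBlDr -ler_pdivrMl//; apply: lb_le_inf.
    by exists (KL s (projection s (mhat w0)) + pen (mhat w0)), (mhat w0).
  move=> _ [m0 /= m0M <-]; rewrite ler_pdivrMl// lerBlDr -lee_fin.
  exact: bound.
by have := bound _ mhM.
Qed.
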